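(* Let $\Gamma,\tilde\Gamma$ be finite groups, $\alpha_1\in\mathrm{Aut}(\Gamma)$, $\tilde\alpha_1\in\mathrm{Aut}(\tilde\Gamma)$, and let $G,\tilde G$ be the fraction groups associated to the triples $(\Gamma,\mathrm{id}_\Gamma,\alpha_1)$ and $(\tilde\Gamma,\mathrm{id}_{\tilde\Gamma},\tilde\alpha_1)$ respectively. If $G$ is isomorphic to $\tilde G$, then there exists an isomorphism $\beta:\Gamma\to\tilde\Gamma$. Moreover, there exist $h\in\Gamma$, $\tilde h\in\tilde\Gamma$ and $n,\tilde n\in\mathbf Z$ such that $$\alpha_1=\mathrm{ad}(h)\circ\beta^{-1}\tilde\alpha_1^{\tilde n}\beta\quad\text{and}\quad\tilde\alpha_1=\mathrm{ad}(\tilde h)\circ\beta\alpha_1^{n}\beta^{-1}.$$ In other words, the map $\gamma\in\mathrm{Aut}(\Gamma)\mapsto\beta\gamma\beta^{-1}\in\mathrm{Aut}(\tilde\Gamma)$ realises an isomorphism from the subgroup generated by $\alpha_1$ in $\mathrm{Out}(\Gamma)=\mathrm{Aut}(\Gamma)/\mathrm{Inn}(\Gamma)$ onto the subgroup generated by $\tilde\alpha_1$ in $\mathrm{Out}(\tilde\Gamma)$.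
   Context: Let $\mathfrak C=\{0,1\}^{\mathbf N}$ be the Cantor space. A standard dyadic interval (sdi) is a set $I=\{m_I\cdot y: y\in\mathfrak C\}$ of all sequences with a given finite prefix $m_I$ (the word of $I$). A standard dyadic partition (sdp) is a finite partition of $\mathfrak C$ into sdi. Thompson's group $V$ is the group of homeomorphisms $v$ of $\mathfrak C$ for which there are two sdp $(I_k)_{k=1}^n$, $(J_k)_{k=1}^n$ with $v(m_{I_k}\cdot x)=m_{J_k}\cdot x$ for all $k$, $x$. An sdi $I$ is adapted to $v$ if there is a finite word $m$ with $v(m_I\cdot x)=m\cdot x$ for all $x\in\mathfrak C$; then $v(I)$ is the sdi with word $m$. For a group $\Gamma$ and $\alpha_0,\alpha_1\in\mathrm{Aut}(\Gamma)$: for a finite word $m=l_1\cdots l_n$ put $\alpha_m=\alpha_{l_n}\circ\cdots\circ\alpha_{l_1}$, and $\alpha_I=\alpha_{m_I}$. $L\Gamma$ is the group (pointwise product) of locally constant maps $a:\mathfrak C\to\Gamma$ (constant on each piece of some sdp). For $v\in V$, $x\in\mathfrak C$ put $\tau_{v,x}=\alpha_{v(I)}^{-1}\circ\alpha_I$ for any sdi $I\ni x$ adapted to $v$ (independent of $I$). The Jones action is $\pi_v(a)(vx)=\tau_{v,x}(a(x))$, and the fraction group associated to $(\Gamma,\alpha_0,\alpha_1)$ is the semidirect product $L\Gamma\rtimes V$ for this action. Here $\alpha_0=\mathrm{id}_\Gamma$ (resp. $\tilde\alpha_0=\mathrm{id}_{\tilde\Gamma}$). $\mathrm{ad}(h)$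 is the inner automorphism $g\mapsto hgh^{-1}$. *)

(* Defs.v *)
From HB Require Import structures.
From mathcomp Require Import all_boot all_order all_algebra all_fingroup.
From mathcomp Require Import boolp classical_sets functions topology cantor.

Set Implicit Arguments.
Unset Strict Implicit.
Unset Printing Implicit Defensive.

Local Open Scope group_scope.

Definition word := seq bool.

Definition prepend (m : word) (x : cantor_space) : cantor_space :=
  fun i => if (i < size m)%N then nth false m i else x (i - size m)%N.

(* Standard dyadic intervals (sdi) and partitions (sdp) of the Cantor space. *)
Definition sdi (m : word) : set cantor_space := range (prepend m).

Definition sdp n (I : 'I_n -> word) : Prop :=
  partition setT (fun k => sdi (I k)) setT.

Definition adapted (v : cantor_space -> cantor_space) (m m' : word) : Prop :=
  forall x, v (prepend m x) = prepend m' x.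

(* The condition singling out the elements of Thompson's group V among the
   homeomorphisms of the Cantor space. *)
Definition prefix_replacing (v : cantor_space -> cantor_space) : Prop :=
  exists n (I J : 'I_n -> word),
    [/\ sdp I, sdp J & forall k, adapted v (I k) (J k)].

Definition locally_constant (T : Type) (a : cantor_space -> T) : Prop :=
  exists n (I : 'I_n -> word),
    sdp I /\ forall k x y, a (prepend (I k) x) = a (prepend (I k) y).

Section Words.

Implicit Types (m : word) (x y : cantor_space).

Lemma prepend_nil x : prepend [::] x = x.
Proof. by apply/funext => i; rewrite /prepend /= subn0. Qed.

Lemma prepend_cat m1 m2 x : prepend (m1 ++ m2) x = prepend m1 (prepend m2 x).
Proof.
apply/funext => i; rewrite /prepend size_cat nth_cat.
case: (ltnP i (size m1)) => [lt1|le1]; first by rewrite ltn_addr.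
by rewrite ltn_subLR // subnDA.
Qed.

Lemma prepend_inj m : injective (prepend m).
Proof.
move=> x y e; apply/funext => i.
have := congr1 (fun f : cantor_space => f (size m + i)%N) e.
by rewrite /prepend ltnNge leq_addr /= addKn.
Qed.

Lemma prepend_prefix m1 m2 x y : prepend m1 x = prepend m2 y ->
  (size m1 <= size m2)%N -> m2 = m1 ++ drop (size m1) m2.
Proof.
move=> e le12; rewrite -{1}(cat_take_drop (size m1) m2); congr (_ ++ _).
apply: (@eq_from_nth _ false) => [|i]; rewrite size_takel // => lti.
rewrite nth_take //; have := congr1 (fun f : cantor_space => f i) e.
by rewrite /prepend lti (leq_trans lti le12).
Qed.

Lemma prepend_wordI m1 m2 : (forall x, prepend m1 x = prepend m2 x) -> m1 = m2.
Proof.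
wlog le12 : m1 m2 / (size m1 <= size m2)%N => [W|] e.
  by case: (leqP (size m1) (size m2)) => [/W->//|/ltnW/W<-//].
have := prepend_prefix (e (fun=> false)) le12.
case: (drop _ _) => [|b s]; first by rewrite cats0.
move=> m2E; have := e (fun=> ~~ b); rewrite m2E prepend_cat => /prepend_inj.
by move=> /(congr1 (fun f : cantor_space => f 0%N)); rewrite /prepend /=; case: (b).
Qed.

Lemma prepend_split N x :
  x = prepend (mkseq x N) (fun i => x (N + i)%N).
Proof.
apply/funext => i; rewrite /prepend size_mkseq.
by case: ltnP => [lti|/subnKC->//]; rewrite nth_mkseq.
Qed.

Lemma sdpP n (I : 'I_n -> word) :
  sdp I <-> (forall x, exists k, sdi (I k) x) /\
            (forall k l x, sdi (I k) x -> sdi (I l) x -> k = l).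
Proof.
split=> [[cov triv _]|[cov triv]].
  split=> [x|k l x kx lx]; last by apply: triv => //; exists x.
  have : setT x by []. by rewrite -cov => -[k _ kx]; exists k.
split.
- by apply/seteqP; split=> // x _; have [k kx] := cov x; exists k.
- by move=> k l _ _ [x [kx lx]]; apply: triv kx lx.
- by move=> k _; exists (prepend (I k) point); exists point.
Qed.

Lemma sdp_bound n (I : 'I_n -> word) : sdp I ->
  exists N, forall m, (N <= size m)%N -> exists k m', m = I k ++ m'.
Proof.
move=> /sdpP[cov _]; exists (\max_k size (I k)) => m lem.
have [k [y _ e]] := cov (prepend m point).
exists k, (drop (size (I k)) m); apply: prepend_prefix e _.
exact: leq_trans (leq_bigmax k) lem.
Qed.

Definition unif_word N (k : 'I_#|{: N.-tuple bool}|) : word := tval (enum_val k).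

Lemma size_unif_word N (k : 'I_#|{: N.-tuple bool}|) : size (unif_word k) = N.
Proof. by rewrite size_tuple. Qed.

Lemma sdp_unif N : sdp (@unif_word N).
Proof.
apply/sdpP; split=> [x|k l x [y _ <-] [z _ e]].
  have sz : size (mkseq x N) == N by rewrite size_mkseq.
  exists (enum_rank (Tuple sz)); rewrite /unif_word enum_rankK /=.
  by exists (fun i => x (N + i)%N) => //; rewrite -prepend_split.
apply/enum_val_inj/val_inj; rewrite -!/(unif_word _).
have := prepend_prefix e; rewrite !size_unif_word => /(_ (leqnn N)) kE.
by rewrite [LHS]kE drop_oversize ?cats0 // size_unif_word.
Qed.

Lemma prefix_replacing_unif v : prefix_replacing v ->
  exists N, forall m, (N <= size m)%N -> exists m', adapted v m m'.
Proof.
move=> [n [I [J [/sdp_bound[N HN] _ ad]]]]; exists N => m /HN[k [s ->]].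
by exists (J k ++ s) => x; rewrite !prepend_cat ad.
Qed.

Lemma unif_prefix_replacing v v' : cancel v v' -> cancel v' v ->
  (exists N, forall m, (N <= size m)%N -> exists m', adapted v m m') ->
  prefix_replacing v.
Proof.
move=> vK v'K [N HN].
have /choice[J adJ] (k : 'I_#|{: N.-tuple bool}|) :
    exists m', adapted v (unif_word k) m'.
  by apply: HN; rewrite size_unif_word.
exists _, (@unif_word N), J.
have sI := sdp_unif N; split=> //.
have [cov triv] := (sdpP _).1 sI; apply/sdpP; split=> [x|k l x].
  have [k [y _ e]] := cov (v' x); exists k; exists y => //.
  by rewrite -adJ e v'K.
move=> [y _ <-] [z _ e]; apply: (triv k l (v' (prepend (J k) y))).
  by exists y => //; rewrite -adJ vK.
by exists z => //; rewrite -e -adJ vK.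
Qed.

Lemma locally_constant_unif T (a : cantor_space -> T) : locally_constant a <->
  exists N, forall m, (N <= size m)%N ->
    forall x y, a (prepend m x) = a (prepend m y).
Proof.
split=> [[n [I [/sdp_bound[N HN] cst]]]|[N HN]].
  exists N => m /HN[k [s ->]] x y; rewrite !prepend_cat; exact: cst.
exists _, (@unif_word N).
by split=> [|k x y]; [exact: sdp_unif|apply: HN; rewrite size_unif_word].
Qed.

End Words.

Record thompsonV := ThompsonV {
  thompson_fun :> cantor_space -> cantor_space;
  thompson_inv : cantor_space -> cantor_space;
  thompson_funK : cancel thompson_fun thompson_inv;
  thompson_invK : cancel thompson_inv thompson_fun;
  thompson_fun_continuous : continuous thompson_fun;
  thompson_inv_continuous : continuous thompson_inv;
  thompson_funP : prefix_replacing thompson_fun }.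

HB.instance Definition _ := gen_eqMixin thompsonV.
HB.instance Definition _ := gen_choiceMixin thompsonV.

Section ThompsonGroup.

Implicit Types u v w : thompsonV.

Lemma thompson_eq u v : (forall x, u x = v x) -> u = v.
Proof.
case: u v => [u u' uK u'K uc u'c uP] [v v' vK v'K vc v'c vP] /= /funext uv.
subst v; have e : u' = v' by apply/funext => x; rewrite -{1}(v'K x) uK.
by subst v'; congr ThompsonV; apply: Prop_irrelevance.
Qed.

Fact thompson_one_P : prefix_replacing (@id cantor_space).
Proof.
apply: (@unif_prefix_replacing _ id) => //.
by exists 0%N => m _; exists m.
Qed.

Definition thompson_one : thompsonV :=
  @ThompsonV id id (fun _ => erefl) (fun _ => erefl)
    (fun x => cvg_id) (fun x => cvg_id) thompson_one_P.

Fact thompson_inv_P v : prefix_replacing (thompson_inv v).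
Proof.
case: v => v v' vK v'K vc v'c [n [I [J [sI sJ ad]]]] /=.
by exists n, J, I; split=> // k x; rewrite -ad vK.
Qed.

Definition thompson_V v : thompsonV :=
  ThompsonV (@thompson_invK v) (@thompson_funK v)
    (@thompson_inv_continuous v) (@thompson_fun_continuous v)
    (thompson_inv_P v).

Fact thompson_mul_P u v : prefix_replacing (u \o v).
Proof.
apply: (unif_prefix_replacing (v' := thompson_inv v \o thompson_inv u)).
- exact: can_comp (@thompson_funK u) (@thompson_funK v).
- exact: can_comp (@thompson_invK v) (@thompson_invK u).
have [N HN] := prefix_replacing_unif (thompson_funP v).
have [M HM] := prefix_replacing_unif (thompson_funP u).
exists (N + M)%N => m lem.
have leN : (N <= size (take N m))%N.
  by rewrite size_takel // (leq_trans (leq_addr M N)).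
have leM : (M <= size (drop N m))%N by rewrite size_drop leq_subRL // (leq_trans (leq_addr M N)).
have [m1 ad1] := HN _ leN.
have [|m2 ad2] := HM (m1 ++ drop N m).
  by rewrite size_cat (leq_trans leM) ?leq_addl.
exists m2 => x; rewrite -ad2 prepend_cat -ad1 -prepend_cat cat_take_drop.
by [].
Qed.

Definition thompson_mul u v : thompsonV :=
  @ThompsonV (u \o v) (thompson_inv v \o thompson_inv u)
    (can_comp (@thompson_funK u) (@thompson_funK v))
    (can_comp (@thompson_invK v) (@thompson_invK u))
    (fun x => continuous_comp (thompson_fun_continuous (x:=x))
                              (thompson_fun_continuous (x:=v x)))
    (fun x => continuous_comp (thompson_inv_continuous (x:=x))
                              (thompson_inv_continuous (x:=thompson_inv u x)))
    (thompson_mul_P u v).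

Fact thompson_mulA : associative thompson_mul.
Proof. by move=> u v w; apply: thompson_eq. Qed.
Fact thompson_mul1 : left_id thompson_one thompson_mul.
Proof. by move=> u; apply: thompson_eq. Qed.
Fact thompson_1mul : right_id thompson_one thompson_mul.
Proof. by move=> u; apply: thompson_eq. Qed.
Fact thompson_mulV : left_inverse thompson_one thompson_V thompson_mul.
Proof. by move=> u; apply: thompson_eq => x; exact: thompson_funK. Qed.
Fact thompson_Vmul : right_inverse thompson_one thompson_V thompson_mul.
Proof. by move=> u; apply: thompson_eq => x; exact: thompson_invK. Qed.

End ThompsonGroup.

HB.instance Definition _ := isGroup.Build thompsonV
  thompson_mulA thompson_mul1 thompson_1mul thompson_mulV thompson_Vmul.

Lemma thompson_mulE (u v : thompsonV) x : (u * v) x = u (v x).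
Proof. by []. Qed.

Lemma thompson_adapted (v : thompsonV) x :
  exists m m', sdi m x /\ adapted v m m'.
Proof.
have [N HN] := prefix_replacing_unif (thompson_funP v).
have [|m' ad] := HN (mkseq x N); first by rewrite size_mkseq.
exists (mkseq x N), m'; split=> //.
by exists (fun i => x (N + i)%N) => //; rewrite -prepend_split.
Qed.

Record LGamma (gT : finGroupType) := LocConst {
  loc_fun :> cantor_space -> gT;
  loc_funP : locally_constant loc_fun }.

Section LGammaGroup.

Variable gT : finGroupType.
Implicit Types a b c : LGamma gT.

HB.instance Definition _ := gen_eqMixin (LGamma gT).
HB.instance Definition _ := gen_choiceMixin (LGamma gT).

Lemma loc_eq a b : (forall x, a x = b x) -> a = b.
Proof.
case: a b => [a aP] [b bP] /= /funext ab; subst b.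
by congr LocConst; apply: Prop_irrelevance.
Qed.

Fact loc_one_P : locally_constant (fun _ : cantor_space => 1 : gT).
Proof. by apply/locally_constant_unif; exists 0%N. Qed.

Fact loc_inv_P a : locally_constant (fun x => (a x)^-1).
Proof.
have [n [I [sI cst]]] := loc_funP a.
by exists n, I; split=> // k x y; rewrite (cst k x y).
Qed.

Fact loc_mul_P a b : locally_constant (fun x => a x * b x).
Proof.
have /locally_constant_unif[N HN] := loc_funP a.
have /locally_constant_unif[M HM] := loc_funP b.
apply/locally_constant_unif; exists (maxn N M) => m.
by rewrite geq_max => /andP[leN leM] x y; rewrite (HN m leN x y) (HM m leM x y).
Qed.

Definition loc_one := LocConst loc_one_P.
Definition loc_inv a := LocConst (loc_inv_P a).
Definition loc_mul a b := LocConst (loc_mul_P a b).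

Fact loc_mulA : associative loc_mul.
Proof. by move=> a b c; apply: loc_eq => x; exact: mulgA. Qed.
Fact loc_mul1 : left_id loc_one loc_mul.
Proof. by move=> a; apply: loc_eq => x; exact: mul1g. Qed.
Fact loc_1mul : right_id loc_one loc_mul.
Proof. by move=> a; apply: loc_eq => x; exact: mulg1. Qed.
Fact loc_mulV : left_inverse loc_one loc_inv loc_mul.
Proof. by move=> a; apply: loc_eq => x; exact: mulVg. Qed.
Fact loc_Vmul : right_inverse loc_one loc_inv loc_mul.
Proof. by move=> a; apply: loc_eq => x; exact: mulgV. Qed.

HB.instance Definition _ := isGroup.Build (LGamma gT)
  loc_mulA loc_mul1 loc_1mul loc_mulV loc_Vmul.

Lemma loc_mulE a b x : (a * b) x = a x * b x.
Proof. by []. Qed.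

End LGammaGroup.

Section JonesAction.

Variables (gT : finGroupType) (a0 a1 : {perm gT}).
Hypotheses (Aa0 : a0 \in Aut [set: gT]%SET) (Aa1 : a1 \in Aut [set: gT]%SET).
Implicit Types (u v : thompsonV) (a b : LGamma gT).

(* The product of {perm gT} applies its left factor first, so this is
   alpha_{l_n} o ... o alpha_{l_1} for m = l_1 ... l_n. *)
Definition alpha_word (m : word) : {perm gT} :=
  \prod_(l <- m) (if l then a1 else a0).

(* tau_{v,x} = alpha_{v(I)}^-1 o alpha_I, with I chosen by [xget]; see tauE for
   the independence of this choice. *)
Definition tau (v : cantor_space -> cantor_space) (x : cantor_space) :
    {perm gT} :=
  let p := xget ([::], [::])
    [set p : word * word | sdi p.1 x /\ adapted v p.1 p.2]%classic in
  alpha_word p.1 * (alpha_word p.2)^-1.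

Lemma alpha_word_cat m m' :
  alpha_word (m ++ m') = alpha_word m * alpha_word m'.
Proof. by rewrite /alpha_word big_cat. Qed.

Lemma alpha_word_Aut m : alpha_word m \in Aut [set: gT]%SET.
Proof. by apply: group_prod => -[]. Qed.

Lemma tauE v x m m' : sdi m x -> adapted v m m' ->
  tau v x = alpha_word m * (alpha_word m')^-1.
Proof.
have aux m1 m1' m2 m2' : (size m1 <= size m2)%N -> sdi m1 x -> sdi m2 x ->
    adapted v m1 m1' -> adapted v m2 m2' ->
    alpha_word m1 * (alpha_word m1')^-1 = alpha_word m2 * (alpha_word m2')^-1.
  move=> le12 [y1 _ e1] [y2 _ e2] ad1 ad2.
  have m2E := prepend_prefix (etrans e1 (esym e2)) le12.
  have m2'E : m2' = m1' ++ drop (size m1) m2.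
    apply: prepend_wordI => y; rewrite -ad2 m2E prepend_cat ad1 -prepend_cat.
    by rewrite drop_size_cat.
  rewrite {}m2'E; move: m2E; move: (drop _ _) => s ->.
  by rewrite !alpha_word_cat invMg mulgA mulgK.
move=> mx ad; rewrite /tau; case: xgetP => [p _ [px pad]|/(_ (m, m'))[]//].
have [le|/ltnW le] := leqP (size p.1) (size m); first exact: aux le _ _ _ _.
by apply/esym; exact: aux le _ _ _ _.
Qed.

Lemma tau_Aut v x : tau v x \in Aut [set: gT]%SET.
Proof. by rewrite groupM ?groupV ?alpha_word_Aut. Qed.

Lemma tau1 x : tau (1 : thompsonV) x = 1.
Proof.
rewrite (@tauE 1 x [::] [::]) ?mulgV //; exists x => //.
exact: prepend_nil.
Qed.

Lemma tauM u v x : tau (u * v) x = tau v x * tau u (v x).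
Proof.
have [N HN] := prefix_replacing_unif (thompson_funP v).
have [M HM] := prefix_replacing_unif (thompson_funP u).
have leN : (N <= size (mkseq x N))%N by rewrite size_mkseq.
have [m1 ad1] := HN _ leN.
set y := fun i => x (N + i)%N.
have [|m2 ad2] := HM (m1 ++ mkseq y M).
  by rewrite size_cat size_mkseq leq_addl.
set m := mkseq x N ++ mkseq y M.
have adm : adapted v m (m1 ++ mkseq y M).
  by move=> z; rewrite !prepend_cat ad1.
have xm : sdi m x.
  exists (fun i => y (M + i)%N) => //.
  by rewrite prepend_cat -prepend_split -prepend_split.
have vxm : sdi (m1 ++ mkseq y M) (v x).
  by have [z _ <-] := xm; exists z => //; rewrite adm.
rewrite (tauE vxm ad2) (tauE xm adm).
rewrite (@tauE (u * v) x m m2) //; first by rewrite mulgA mulgKV.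
by move=> z; rewrite thompson_mulE adm ad2.
Qed.

Fact jones_P v a : locally_constant
  (fun y => tau v (thompson_inv v y) (a (thompson_inv v y))).
Proof.
have /locally_constant_unif[N HN] := loc_funP a.
have [n [I [J [sI sJ ad]]]] := thompson_funP v^-1.
apply/locally_constant_unif.
exists (\max_k size (I k) + N)%N => m lem x y.
have leI k : (size (I k) + N <= size m)%N.
  by apply: leq_trans lem; rewrite leq_add2r (leq_bigmax k).
have [k [s mE]] : exists k s, m = I k ++ s.
  have [cov _] := (sdpP I).1 sI; have [k [z _ e]] := cov (prepend m x).
  exists k, (drop (size (I k)) m); apply: prepend_prefix e _.
  by apply: leq_trans (leI k); rewrite leq_addr.
have les : (N <= size s)%N by have := leI k; rewrite mE size_cat leq_add2l.
have adJ z : thompson_inv v (prepend m z) = prepend (J k ++ s) z.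
  by rewrite mE !prepend_cat; apply: (ad k).
have adv : adapted v (J k ++ s) m.
  by move=> z; rewrite -adJ thompson_invK.
rewrite !adJ !(tauE _ adv); try by eexists.
congr (_ _); apply: HN; rewrite size_cat.
exact: leq_trans les (leq_addl _ _).
Qed.

(* jones v a is pi_v(a), characterised by pi_v(a)(v x) = tau_{v,x}(a x): jonesE. *)
Definition jones v a : LGamma gT := LocConst (jones_P v a).

Lemma jonesE v a x : jones v a (v x) = tau v x (a x).
Proof. by rewrite /= thompson_funK. Qed.

Lemma jones_ext v a b : (forall x, a (v x) = b (v x)) -> a = b.
Proof. by move=> ab; apply: loc_eq => x; rewrite -(thompson_invK v x) ab. Qed.

Lemma jones1 a : jones 1 a = a.
Proof. by apply: (@jones_ext 1) => x; rewrite jonesE tau1 perm1. Qed.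

Lemma jonesM u v a : jones (u * v) a = jones u (jones v a).
Proof.
apply: (@jones_ext (u * v)) => x.
by rewrite jonesE tauM permM thompson_mulE !jonesE.
Qed.

Lemma jones_mul v a b : jones v (a * b) = jones v a * jones v b.
Proof.
apply: (@jones_ext v) => x; rewrite loc_mulE !jonesE loc_mulE.
by have /morphicP-> := Aut_morphic (tau_Aut v x); rewrite ?inE.
Qed.

Lemma jones_one v : jones v 1 = 1.
Proof. by apply: (mulgI (jones v 1)); rewrite -jones_mul !mulg1. Qed.

Lemma jones_inv v a : jones v a^-1 = (jones v a)^-1.
Proof. by apply: (mulgI (jones v a)); rewrite -jones_mul !mulgV jones_one. Qed.

End JonesAction.

(* L Gamma x| V for the Jones action.  The two proof arguments only serve to
   make the group laws provable. *)
Record fraction_group (gT : finGroupType) (a0 a1 : {perm gT})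
    (Aa0 : a0 \in Aut [set: gT]%SET) (Aa1 : a1 \in Aut [set: gT]%SET) :=
  FracElt { frac_L : LGamma gT; frac_V : thompsonV }.

Section FractionGroup.

Variables (gT : finGroupType) (a0 a1 : {perm gT}).
Variables (Aa0 : a0 \in Aut [set: gT]%SET) (Aa1 : a1 \in Aut [set: gT]%SET).
Local Notation G := (fraction_group Aa0 Aa1).
Implicit Types g h : G.

HB.instance Definition _ := gen_eqMixin G.
HB.instance Definition _ := gen_choiceMixin G.

Definition frac_one : G := FracElt Aa0 Aa1 1 1.
Definition frac_mul g h : G :=
  FracElt Aa0 Aa1 (frac_L g * jones a0 a1 (frac_V g) (frac_L h))
                  (frac_V g * frac_V h).
Definition frac_inv g : G :=
  FracElt Aa0 Aa1 (jones a0 a1 (frac_V g)^-1 (frac_L g)^-1) (frac_V g)^-1.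

Fact frac_mulA : associative frac_mul.
Proof.
move=> [a u] [b v] [c w]; congr FracElt; rewrite /= ?mulgA //.
by rewrite jones_mul // -jonesM mulgA.
Qed.
Fact frac_mul1 : left_id frac_one frac_mul.
Proof. by move=> [a u]; congr FracElt; rewrite /= ?jones1 mul1g. Qed.
Fact frac_1mul : right_id frac_one frac_mul.
Proof. by move=> [a u]; congr FracElt; rewrite /= ?jones_one ?mulg1. Qed.
Fact frac_mulV : left_inverse frac_one frac_inv frac_mul.
Proof.
move=> [a u]; congr FracElt; rewrite /= ?mulVg //.
by rewrite -jones_mul // mulVg jones_one.
Qed.
Fact frac_Vmul : right_inverse frac_one frac_inv frac_mul.
Proof.
move=> [a u]; congr FracElt; rewrite /= ?mulgV //.
by rewrite -jonesM mulgV jones1 mulgV.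
Qed.

HB.instance Definition _ := isGroup.Build G
  frac_mulA frac_mul1 frac_1mul frac_mulV frac_Vmul.

End FractionGroup.

Record group_iso (G H : groupType) := GroupIso {
  iso_fun :> {multiplicative G -> H};
  iso_inv : H -> G;
  iso_funK : cancel iso_fun iso_inv;
  iso_invK : cancel iso_inv iso_fun }.

Definition isomorphic (G H : groupType) : Prop := inhabited (group_iso G H).

Definition expgz (G : groupType) (x : G) (n : int) : G :=
  match n with Posz k => x ^+ k | Negz k => x ^- k.+1 end.

Definition ad (G : groupType) (h : G) : G -> G := fun g => h * g * h^-1.

Section Out.

Variables (gT rT : finGroupType).

(* [conj_aut _ x] is ad x^-1, so the image of conj_aut is the group of all the
   ad h; see InnP. *)
Definition Inn : {group {perm gT}} :=
  (conj_aut [set: gT]%SET @* [set: gT]%SET)%G.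

Lemma InnP (g : {perm gT}) : reflect (exists h, g =1 ad h) (g \in Inn).
Proof.
have conjE h : conj_aut [set: gT]%SET h =1 ad h^-1.
  by move=> y; rewrite conj_autE ?inE // /ad invgK -mulgA.
apply: (iffP morphimP) => [[h _ _ ->]|[h gE]]; first by exists h^-1; apply: conjE.
have nG (x : gT) : x \in 'N([set: gT]%SET).
  by rewrite (fintype.subsetP (normG [set: gT]%G)) ?inE.
exists h^-1; rewrite ?nG ?inE //; apply/permP => y.
by rewrite gE -[RHS]/(conj_aut [set: gT]%SET h^-1 y) conjE invgK.
Qed.

(* Hence [coset Inn] is the projection of Aut [set: gT] onto Out. *)
Lemma Aut_norm_Inn : Aut [set: gT]%SET \subset 'N(Inn).
Proof.
apply/fintype.subsetP => a Aa; rewrite inE.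
apply/fintype.subsetP => _ /imsetP[g /InnP[h gE] ->].
have aM : {morph a : x y / x * y}.
  by move=> x y; rewrite (morphicP (Aut_morphic Aa)) ?inE.
have a1 : a 1 = 1 by apply: (mulgI (a 1)); rewrite -aM !mulg1.
have aV x : a x^-1 = (a x)^-1 by apply: (mulgI (a x)); rewrite -aM !mulgV.
apply/InnP; exists (a h) => y.
by rewrite conjgE !permM gE /ad !aM aV permKV.
Qed.

Fact conj_iso_inj (beta : group_iso gT rT) (g : {perm gT}) :
  injective (beta \o g \o iso_inv beta).
Proof.
apply: inj_comp (can_inj (@iso_invK _ _ beta)).
exact: inj_comp (can_inj (@iso_funK _ _ beta)) perm_inj.
Qed.

Definition conj_iso (beta : group_iso gT rT) (g : {perm gT}) : {perm rT} :=
  perm (@conj_iso_inj beta g).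

Lemma iso_invM (beta : group_iso gT rT) : {morph iso_inv beta : x y / x * y}.
Proof.
move=> x y; apply: (can_inj (@iso_funK _ _ beta)).
by rewrite gmulfM !iso_invK.
Qed.

Lemma conj_iso_Aut (beta : group_iso gT rT) (g : {perm gT}) :
  g \in Aut [set: gT]%SET -> conj_iso beta g \in Aut [set: rT]%SET.
Proof.
move=> Ag; rewrite inE; apply/andP; split; first by apply/fintype.subsetP => x; rewrite inE.
apply/morphicP => x y _ _; rewrite !permE /= iso_invM.
by rewrite (morphicP (Aut_morphic Ag)) ?inE // gmulfM.
Qed.

End Out.

(* Main.v *)
(** Let th : G -> G' be an isomorphism.  Every normal subgroup of G' of finite
    exponent lies in L Gam', so th maps L Gam onto L Gam' and induces an
    automorphism psi of V.  Call an interval visible from a point y when psi c y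
    differs from y for some M-cycle c of subintervals of it, M being a large
    integer congruent to 1 modulo 12 |Gam'|.  By Rubin's algebraic
    characterisation of disjointness, disjoint sets are not both visible, and
    since cycles supported in a union of two overlapping sets are generated by
    cycles supported in either, the intervals visible from y are those
    containing one point x.  If p is an interval avoiding x, cycles in p act
    trivially near y, so the homomorphisms Gam -> Gam' obtained by evaluating
    th at y on functions supported in the subintervals of p agree after
    normalisation by alpha; since a function on p is the product of its
    restrictions to the two halves, they are all trivial.  So the value of th a
    at y depends only on a x, through an isomorphism beta : Gam -> Gam'.
    Taking x = 111... and v in V fixing x with tau_{v,x} = alpha_1 yields the
    first relation; the second one follows from it, and from the same relation
    for the inverse of th, by comparing orders in the outer automorphism
    groups. *)

From HB Require Import structures.
Require Import Defs.
From mathcomp Require Import all_boot all_order all_algebra all_fingroup.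
From mathcomp Require Import cyclic.
From mathcomp Require Import boolp classical_sets topology cantor.

Set Implicit Arguments.
Unset Strict Implicit.
Unset Printing Implicit Defensive.

Local Open Scope group_scope.

(** * Homomorphisms between arbitrary groups *)

Section MorphismIdentities.

Variables (G H : groupType) (f : G -> H).
Hypothesis fM : {morph f : g h / g * h}.

Lemma morph_one : f 1 = 1.
Proof. by apply: (mulgI (f 1)); rewrite -fM !mulg1. Qed.

Lemma morph_inv : {morph f : g / g^-1}.
Proof. by move=> g; apply: (mulgI (f g)); rewrite -fM !mulgV morph_one. Qed.

Lemma morph_exp n : {morph f : g / g ^+ n}.
Proof.
by move=> g; elim: n => [|n IHn]; rewrite ?morph_one // !expgS fM IHn.
Qed.

Lemma morph_commg : {morph f : g h / [~ g, h]}.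
Proof. by move=> g h; rewrite !commgEl !conjgE !fM !morph_inv. Qed.

Lemma morph_commute g h : commute g h -> commute (f g) (f h).
Proof. by rewrite /commute -!fM => ->. Qed.

End MorphismIdentities.

(** * Prefixes and the topology of the Cantor space *)

Definition starts (m : word) (x : cantor_space) : bool := mkseq x (size m) == m.

Definition shift (n : nat) (x : cantor_space) : cantor_space :=
  fun i => x (n + i)%N.

Section Prefixes.

Implicit Types (m s : word) (x y z : cantor_space).

Lemma shift_prepend m z : shift (size m) (prepend m z) = z.
Proof.
by apply/funext => i; rewrite /shift /prepend ltnNge leq_addr /= addKn.
Qed.

Lemma starts_nth m x :
  reflect (forall i, (i < size m)%N -> x i = nth false m i) (starts m x).
Proof.
apply: (iffP eqP) => [e i lti|e]; first by rewrite -e nth_mkseq.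
apply: (@eq_from_nth _ false) => [|i]; rewrite size_mkseq // => lti.
by rewrite nth_mkseq // e.
Qed.

Lemma starts_prepend m z : starts m (prepend m z).
Proof. by apply/starts_nth => i lti; rewrite /prepend lti. Qed.

Lemma starts_prependK m x : starts m x -> prepend m (shift (size m) x) = x.
Proof. by move=> /eqP e; rewrite {2}[x](prepend_split (size m)) e. Qed.

Lemma sdiP m x : sdi m x <-> starts m x.
Proof.
split=> [[z _ <-]|/starts_prependK <-]; first exact: starts_prepend.
by exists (shift (size m) x).
Qed.

Lemma starts_cat m s x :
  starts (m ++ s) x = starts m x && starts s (shift (size m) x).
Proof.
apply/idP/andP => [/starts_prependK <-|[/starts_prependK + /starts_prependK]].
  by rewrite prepend_cat shift_prepend !starts_prepend.
by move=> e1 e2; rewrite -e1 -e2 -prepend_cat starts_prepend.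
Qed.

Lemma starts_catl m s x : starts (m ++ s) x -> starts m x.
Proof. by rewrite starts_cat => /andP[]. Qed.

Lemma starts_cat_prepend m s z : starts (m ++ s) (prepend m z) = starts s z.
Proof. by rewrite starts_cat starts_prepend shift_prepend. Qed.

Lemma starts_mkseq x n : starts (mkseq x n) x.
Proof. by rewrite /starts size_mkseq. Qed.

Lemma mkseq_shift x n k : mkseq x (n + k) = mkseq x n ++ mkseq (shift n x) k.
Proof.
by rewrite /mkseq iotaD map_cat add0n -[n in iota n k]addn0 iotaDl -map_comp.
Qed.

Lemma starts_size m s x : starts m x -> starts s x -> (size m <= size s)%N ->
  s = m ++ drop (size m) s.
Proof.
move=> /starts_prependK mx /starts_prependK sx.
exact: prepend_prefix (etrans mx (esym sx)).
Qed.

Lemma starts_deep m s z y : (size m <= size s)%N ->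
  starts m (prepend s z) = starts m (prepend s y).
Proof.
move=> le; apply/starts_nth/starts_nth => e i lti; move: (e i lti).
all: by rewrite /prepend (leq_trans lti le).
Qed.

Lemma starts_inj_size m s x : starts m x -> starts s x -> size m = size s ->
  m = s.
Proof.
by move=> mx sx e; rewrite [RHS](starts_size mx sx) ?e // drop_size cats0.
Qed.

End Prefixes.

Lemma nbhs_starts (x : cantor_space) n :
  nbhs x [set z : cantor_space | starts (mkseq x n) z]%classic.
Proof.
elim: n => [|n IHn].
  by apply: filterS filterT => z _; apply/starts_nth.
have nx : nbhs x [set z : cantor_space | z n = x n]%classic.
  have := @proj_continuous nat (fun _ => bool) n x [set x n]%classic.
  by apply; apply: open_nbhs_nbhs; split=> //; exact: discrete_open.
apply: filterS (filterI IHn nx) => z [/starts_nth + zn].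
rewrite size_mkseq => e; apply/starts_nth => i; rewrite size_mkseq ltnS => lei.
rewrite nth_mkseq //; move: lei; rewrite leq_eqVlt => /orP[/eqP->//|lti].
by rewrite e // nth_mkseq.
Qed.

Lemma locally_adapted_coord v :
  (exists N, forall m, (N <= size m)%N -> exists m', adapted v m m') ->
  forall x i, exists N, forall z, starts (mkseq x N) z -> v z i = v x i.
Proof.
move=> [N HN] x i; have [|m' ad] := HN (mkseq x N); first by rewrite size_mkseq.
exists (N + i.+1)%N => z; rewrite mkseq_shift => zs.
have xs := starts_mkseq x (N + i.+1); rewrite mkseq_shift in xs.
have vE t : starts (mkseq x N ++ mkseq (shift N x) i.+1) t ->
    v t i = nth false (m' ++ mkseq (shift N x) i.+1) i.
  move=> /starts_prependK <-; rewrite prepend_cat ad -prepend_cat /prepend.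
  by rewrite size_cat size_mkseq addnS ltnS leq_addl.
by rewrite !vE.
Qed.

Lemma prefix_continuous v :
  (exists N, forall m, (N <= size m)%N -> exists m', adapted v m m') ->
  continuous v.
Proof.
move=> Hv x; apply/pointwise_cvgP => i A /nbhs_singleton Avxi.
have [N e] := locally_adapted_coord Hv x i.
by apply: filterS (nbhs_starts x N) => z /e /= ->.
Qed.

(** * Thompson's group and its cyclic elements *)

Lemma starts_mkseq_le (x z : cantor_space) n k : (n <= k)%N ->
  starts (mkseq x k) z -> starts (mkseq x n) z.
Proof. by move=> /subnKC <-; rewrite mkseq_shift => /starts_catl. Qed.

(** Some coordinate separates [v x] from [x], and that coordinate of [v z] depends only on a finite
    prefix of [z]. *)
Lemma displaced_nbhd (v : thompsonV) x : v x <> x -> exists N, forall n,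
  (N <= n)%N -> forall z, starts (mkseq x n) z -> ~~ starts (mkseq x n) (v z).
Proof.
move=> vx; have [i vxi] : exists i, v x i <> x i.
  by apply: contrapT => /forallNP e; apply/vx/funext => i; apply: contrapT.
have [N HN] := locally_adapted_coord (prefix_replacing_unif (thompson_funP v)) x i.
exists (maxn N i.+1) => n; rewrite geq_max => /andP[leN lti] z zn.
apply/negP => /starts_nth /(_ i); rewrite size_mkseq nth_mkseq // => /(_ lti).
by rewrite (HN z) // (starts_mkseq_le leN).
Qed.

Lemma thompson_exists (v v' : cantor_space -> cantor_space) :
  cancel v v' -> cancel v' v ->
  (exists N, forall m, (N <= size m)%N -> exists m', adapted v m m') ->
  (exists N, forall m, (N <= size m)%N -> exists m', adapted v' m m') ->
  exists u : thompsonV, forall x, u x = v x.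
Proof.
move=> vK v'K Hv Hv'; exists (ThompsonV vK v'K (@prefix_continuous v Hv)
  (@prefix_continuous _ Hv') (unif_prefix_replacing vK v'K Hv)).
by [].
Qed.

Section ThompsonPointwise.

Implicit Types (u v : thompsonV).

Lemma thompson_inj v : injective v.
Proof. exact: can_inj (@thompson_funK v). Qed.

Lemma thompsonK v x : v^-1 (v x) = x.
Proof. exact: thompson_funK. Qed.

Lemma thompsonVK v x : v (v^-1 x) = x.
Proof. exact: thompson_invK. Qed.

Lemma thompson1E x : (1 : thompsonV) x = x.
Proof. by []. Qed.

Lemma thompson_expgS v n x : (v ^+ n.+1) x = v ((v ^+ n) x).
Proof. by rewrite expgS. Qed.

Lemma thompson_fixX v n x : v x = x -> (v ^+ n) x = x.
Proof. by move=> e; elim: n => // n IHn; rewrite thompson_expgS IHn. Qed.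

Lemma thompson_fixV v x : v x = x -> v^-1 x = x.
Proof. by move=> e; rewrite -{1}e thompsonK. Qed.

Lemma thompson_neq1 v : v <> 1 -> exists x, v x <> x.
Proof.
move=> v1; apply: contrapT => /forallNP e; apply/v1/thompson_eq => x.
exact: contrapT.
Qed.

End ThompsonPointwise.

(** * Cyclic permutations of disjoint intervals *)

Section Cycles.

Variable K : nat.
Implicit Types (w : 'I_K.+2 -> word) (c v : thompsonV).

Definition antichain (I : Type) (w : I -> word) : Prop :=
  forall i j x, starts (w i) x -> starts (w j) x -> i = j.

(** Indices are added modulo [K.+2]; the offset 2 makes ['I_K.+2] a nonzero ring, so that a cycle is
    never trivial. *)
Definition is_cycle c w : Prop :=
  [/\ antichain w, forall i, adapted c (w i) (w (i + 1)%R)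
    & forall x, (forall i, ~~ starts (w i) x) -> c x = x].

Definition rotate w (d : 'I_K.+2) (x : cantor_space) : cantor_space :=
  if [pick i | starts (w i) x] is Some i
  then prepend (w (i + d)%R) (shift (size (w i)) x) else x.

Lemma rotate_prepend w d i z : antichain w ->
  rotate w d (prepend (w i) z) = prepend (w (i + d)%R) z.
Proof.
move=> aw; rewrite /rotate; case: pickP => [j wj|/(_ i)].
  by rewrite (aw _ _ _ wj (starts_prepend _ _)) shift_prepend.
by rewrite starts_prepend.
Qed.

Lemma rotate_id w d x : (forall i, ~~ starts (w i) x) -> rotate w d x = x.
Proof. by rewrite /rotate; case: pickP => // i wi /(_ i); rewrite wi. Qed.

Lemma rotateK w d e : antichain w -> (d + e = 0)%R ->
  cancel (rotate w d) (rotate w e).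
Proof.
move=> aw de x; case: (pickP (fun i => starts (w i) x)) => [i|no].
  move=> /starts_prependK <-.
  by rewrite !rotate_prepend // -GRing.addrA de GRing.addr0.
by rewrite !rotate_id // => i; rewrite no.
Qed.

Lemma rotate_unif w d : antichain w ->
  exists N, forall m, (N <= size m)%N -> exists m', adapted (rotate w d) m m'.
Proof.
move=> aw; exists (\max_i size (w i)) => m lem.
have lei i : (size (w i) <= size m)%N := leq_trans (leq_bigmax i) lem.
case: (pickP (fun i => starts (w i) (prepend m point))) => [i wi|no].
  rewrite (starts_size wi (starts_prepend _ _) (lei i)).
  exists (w (i + d)%R ++ drop (size (w i)) m) => x.
  by rewrite !prepend_cat rotate_prepend.
exists m => x; apply: rotate_id => i.
by rewrite (starts_deep _ point (lei i)) no.
Qed.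

Lemma cycle_exists w : antichain w -> exists c, is_cycle c w.
Proof.
move=> aw; have [c cE] := thompson_exists (rotateK aw (GRing.subrr 1%R))
  (rotateK aw (GRing.addNr 1%R)) (rotate_unif _ aw) (rotate_unif _ aw).
exists c; split=> // [i z|x no]; rewrite cE; first exact: rotate_prepend.
exact: rotate_id.
Qed.

Lemma cycle_adaptedX c w n i : is_cycle c w ->
  adapted (c ^+ n) (w i) (w (i + n%:R)%R).
Proof.
move=> [_ ad _]; elim: n => [|n IHn] z; first by rewrite GRing.addr0.
by rewrite thompson_expgS IHn ad -GRing.addrA GRing.natr1.
Qed.

Lemma cycle_order c w : is_cycle c w -> c ^+ K.+2 = 1.
Proof.
move=> cw; apply: thompson_eq => x.
case: (pickP (fun i => starts (w i) x)) => [i|no].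
  move=> /starts_prependK <-; rewrite (cycle_adaptedX _ _ cw).
  suff -> : (K.+2%:R = 0 :> 'I_K.+2)%R by rewrite GRing.addr0.
  by rewrite Zp_nat; apply: val_inj; exact: modnn.
by rewrite thompson_fixX //; case: cw => _ _ -> // i; rewrite no.
Qed.

Lemma cycle_neq1 c w : is_cycle c w -> c <> 1.
Proof.
move=> [aw ad _] c1; have := ad 0%R point; rewrite c1 thompson1E GRing.add0r => e.
have := starts_prepend (w 1%R) point; rewrite -e => w1.
by have := aw _ _ _ (starts_prepend (w 0%R) point) w1.
Qed.

Lemma cycle_conj c v w w' : is_cycle c w -> (forall i, adapted v (w i) (w' i)) ->
  is_cycle (v * c * v^-1) w'.
Proof.
move=> [aw ad cid] vw.
have sw' i x : starts (w' i) x = starts (w i) (v^-1 x).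
  apply/idP/idP => [/starts_prependK <-|/starts_prependK e].
    by rewrite -vw thompsonK starts_prepend.
  by rewrite -(thompsonVK v x) -e vw starts_prepend.
split=> [i j x|i z|x no]; first by rewrite !sw'; apply: aw.
  by rewrite !thompson_mulE -vw thompsonK ad vw.
by rewrite !thompson_mulE cid ?thompsonVK // => i; rewrite -sw'.
Qed.

Lemma antichain_cat (I : Type) (w : I -> word) (s : I -> word) :
  antichain w -> antichain (fun i => w i ++ s i).
Proof. by move=> aw i j x /starts_catl wi /starts_catl; apply: aw. Qed.

Lemma cycle_eq c c' w : is_cycle c w -> is_cycle c' w -> c = c'.
Proof.
move=> [aw ad cid] [_ ad' cid']; apply: thompson_eq => x.
case: (pickP (fun i => starts (w i) x)) => [i|no].
  by move=> /starts_prependK <-; rewrite ad ad'.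
by rewrite cid ?cid' // => i; rewrite no.
Qed.

Lemma cycle_split1 c w : is_cycle c w -> exists c0 c1,
  [/\ is_cycle c0 (fun i => rcons (w i) false),
      is_cycle c1 (fun i => rcons (w i) true) & c = c0 * c1].
Proof.
move=> cw; have [aw _ _] := cw.
have ab b : antichain (fun i => rcons (w i) b).
  by move=> i j x; rewrite -!cats1 => /starts_catl wi /starts_catl; apply: aw.
have [c0 cw0] := cycle_exists (ab false); have [c1 cw1] := cycle_exists (ab true).
exists c0, c1; split=> //; apply: (cycle_eq cw).
have E c2 b i z : is_cycle c2 (fun i => rcons (w i) b) ->
    c2 (prepend (w i) z) = prepend (if z 0%N == b then w (i + 1)%R else w i) z.
  move=> [_ ad cid]; case: eqP => zb.
    have := ad i (shift 1 z); rewrite -!cats1 !prepend_cat.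
    suff -> : prepend [:: b] (shift 1 z) = z by [].
    apply: (starts_prependK (m := [:: b])); apply/starts_nth => -[|//] _; exact: zb.
  apply: cid => j; apply/negP; rewrite -cats1 => s.
  have ij := aw _ _ _ (starts_catl s) (starts_prepend (w i) z).
  move: s; rewrite ij starts_cat_prepend => /starts_nth/(_ 0%N erefl); exact: zb.
split=> // [i z|x no].
  by rewrite thompson_mulE (E _ _ _ _ cw1); case: ifP => zb;
    rewrite (E _ _ _ _ cw0); case: (z 0%N) zb.
have idb c2 b : is_cycle c2 (fun i => rcons (w i) b) -> c2 x = x.
  by move=> [_ _ ->] // i; rewrite -cats1; apply/negP => /starts_catl; apply/negP.
by rewrite thompson_mulE (idb _ _ cw1) (idb _ _ cw0).
Qed.

(** Repeated halving writes a cycle as a product of cycles with arbitrarily long words, so a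
    property stable under products need only be checked on deep subintervals. *)
Lemma cycle_split (P : thompsonV -> Prop) n c w : is_cycle c w ->
  (forall u v, P u -> P v -> P (u * v)) ->
  (forall s c', size s = n -> is_cycle c' (fun i => w i ++ s) -> P c') -> P c.
Proof.
move=> cw PM; elim: n c w cw => [|n IHn] c w cw Pc.
  by apply: (Pc [::]) => //; under eq_fun do rewrite cats0.
have [c0 [c1 [cw0 cw1 ->]]] := cycle_split1 cw.
apply: PM; [apply: IHn cw0 _|apply: IHn cw1 _] => s c' sn cs.
  apply: (Pc (false :: s)); first by rewrite /= sn.
  by move: cs; under eq_fun do rewrite cat_rcons.
apply: (Pc (true :: s)); first by rewrite /= sn.
by move: cs; under eq_fun do rewrite cat_rcons.
Qed.

End Cycles.

Definition word_pair (p q : word) (i : 'I_2) : word :=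
  if i == ord0 then p else q.

Lemma word_pair_antichain p q :
  (forall x, starts p x -> ~~ starts q x) -> antichain (word_pair p q).
Proof.
move=> pq i j x; rewrite /word_pair.
case: i j => [[|[|//]] lti] [[|[|//]] ltj] /= wi wj; try exact: val_inj.
  by move: (pq _ wi); rewrite wj.
by move: (pq _ wj); rewrite wi.
Qed.

(** * Rubin's disjointness argument *)

Section Support.

Implicit Types (f g h v : thompsonV) (J : word).

Definition supported (v : thompsonV) (J : word) : Prop :=
  forall x, ~~ starts J x -> v x = x.

Lemma supportedV v J : supported v J -> supported v^-1 J.
Proof. by move=> vJ x /vJ; exact: thompson_fixV. Qed.

Lemma supported_starts v J x : supported v J -> starts J (v x) = starts J x.
Proof.
move=> vJ; apply/idP/idP => Jx; apply: contraT => nJ.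
  by rewrite vJ // (negPf nJ) in Jx.
by move: (supportedV vJ nJ) (nJ); rewrite thompsonK => <-; rewrite Jx.
Qed.

Lemma disjoint_support_commute f g :
  (forall x, f x = x \/ g x = x) -> commute f g.
Proof.
move=> fg; apply: thompson_eq => x; rewrite !thompson_mulE.
have [fx|gx] := fg x.
  have [fgx|/thompson_inj gx] := fg (g x); first by rewrite fgx fx.
  by rewrite gx fx gx.
have [/thompson_inj fx|gfx] := fg (f x); first by rewrite fx gx fx.
by rewrite gx gfx.
Qed.

Lemma supported_commute f J g : supported f J ->
  (forall x, starts J x -> g x = x) -> commute f g.
Proof.
move=> fJ gJ; apply: disjoint_support_commute => x.
by have [Jx|nJx] := boolP (starts J x); [right; apply: gJ|left; apply: fJ].
Qed.

Lemma cycle_supported K (c : thompsonV) (w : 'I_K.+2 -> word) J :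
  is_cycle c w -> (forall i, prefix J (w i)) -> supported c J.
Proof.
move=> [_ _ cid] Jw x; move=> nJ; apply: cid => i; apply: contra nJ.
by have /prefixP[s ->] := Jw i; exact: starts_catl.
Qed.

(** The transpositions [f] of J01 with J00 and [g] of J01 with J11 share exactly one interval, so
    they do not commute. *)
Lemma noncommuting_pair J :
  exists f g, [/\ supported f J, supported g J & ~ commute f g].
Proof.
pose w b := word_pair (J ++ [:: false; true]) (J ++ [:: b; b]).
have ac b : antichain (w b).
  apply: word_pair_antichain => x; rewrite !starts_cat => /andP[-> xft] /=.
  move: xft => /starts_nth xft; apply/negP => /starts_nth xbb.
  have := xft 0%N erefl; have := xft 1%N erefl.
  by have := xbb 0%N erefl; have := xbb 1%N erefl => /= -> ->; case: b {xbb}.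
have [f fw] := cycle_exists (ac false); have [g gw] := cycle_exists (ac true).
exists f, g; split.
- apply: cycle_supported fw _ => i.
  by rewrite /w /word_pair; case: ifP => _; apply: prefix_prefix.
- apply: cycle_supported gw _ => i.
  by rewrite /w /word_pair; case: ifP => _; apply: prefix_prefix.
move=> fg; have [_ fad _] := fw; have [_ gad gid] := gw.
pose z : cantor_space := fun=> false.
have e1 : f (prepend (w false (1%R : 'I_2)) z) = prepend (w false ord0) z.
  by rewrite fad; congr prepend; congr (w _ _); apply: val_inj.
have e2 : g (prepend (w true ord0) z) = prepend (w true (1%R : 'I_2)) z.
  by rewrite gad; congr prepend; congr (w _ _); apply: val_inj.
have e3 : g (prepend (w false (1%R : 'I_2)) z) = prepend (w false (1%R : 'I_2)) z.
  apply: gid => -[[|[|//]] lti]; by rewrite /w /word_pair /= prepend_cat starts_cat_prepend.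
have := congr1 (fun u : thompsonV => u (prepend (w false (1%R : 'I_2)) z)) fg.
rewrite !thompson_mulE e3 e1 e2 /w /word_pair /= !prepend_cat => /prepend_inj.
by move=> /(congr1 (fun x : cantor_space => x 0%N)).
Qed.

(* The first half of Rubin's algebraic characterisation of disjointness. *)
Lemma disjoint_commutators f g h :
  (forall x, f x = x \/ g x = x) -> ~ commute f h ->
  exists f1 f2, [/\ commute f1 g, commute f2 g, [~ f1, [~ f2, h]] <> 1
                  & commute [~ f1, [~ f2, h]] g].
Proof.
move=> fg nfh; have [p [fp hp]] : exists p, f p <> p /\ h p <> p.
  apply: contrapT => /forallNP no; apply/nfh/disjoint_support_commute => x.
  by have /not_andP[/contrapT|/contrapT] := no x; [left|right].
have hVp : h^-1 p <> p by move=> e; apply: hp; rewrite -{1}e thompsonVK.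
have [N HN] := displaced_nbhd fp; have [N' HN'] := displaced_nbhd hVp.
pose J := mkseq p (maxn N N').
have fJ x : starts J x -> f x <> x.
  by move=> Jx fx; have := HN _ (leq_maxl N N') x Jx; rewrite fx Jx.
have hJ x : starts J x -> ~~ starts J (h^-1 x) by apply: HN'; apply: leq_maxr.
have [f1 [f2 [f1J f2J nc]]] := noncommuting_pair J.
have gJ x : starts J x -> g x = x by move=> Jx; have [/(fJ _ Jx)|] := fg x.
have f1g := supported_commute f1J gJ; have f2g := supported_commute f2J gJ.
have kJ x : starts J x -> (f2 ^ h) x = x.
  move=> Jx; rewrite conjgE !thompson_mulE f2J ?thompsonK //.
  apply/negP => /hJ; rewrite thompsonK Jx; by [].
(* [f2 ^ h] is trivial on [J], so it commutes with [f1 ^ f2^-1], which is supported in [J], and the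
   double commutator collapses. *)
have e : [~ f1, [~ f2, h]] = [~ f1, f2^-1].
  rewrite commgEl (commgEl f2 h) conjgM [_ ^ (f2 ^ h)]conjgE.
  have -> : f1 ^ f2^-1 * (f2 ^ h) = (f2 ^ h) * f1 ^ f2^-1.
    apply: (@supported_commute _ J) => // x nJx.
    rewrite conjgE invgK !thompson_mulE f1J ?thompsonVK //.
    by rewrite (supported_starts _ (supportedV f2J)).
  by rewrite mulKg -commgEl.
exists f1, f2; split=> //; rewrite e.
  by move=> /eqP/commgP/commuteV; rewrite invgK.
have ->: [~ f1, f2^-1] = f1^-1 * f2 * f1 * f2^-1.
  by rewrite commgEl conjgE invgK !mulgA.
apply/commute_sym.
by do 3?[apply: commuteM]; do ?apply: commuteV; apply: commute_sym.
Qed.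

End Support.

Section Transport.

Variables psi psi' : thompsonV -> thompsonV.
Hypotheses (psiK : cancel psi psi') (psi'K : cancel psi' psi).
Hypothesis psiM : {morph psi : u v / u * v}.
Implicit Types (f g h v : thompsonV).

(* The second half of Rubin's characterisation: 12 is the least common multiple
   of 1, 2, 3, 4, the return times that must be excluded for five translates of
   a small interval to be disjoint. *)
Lemma disjoint_transport f g y : (forall x, f x = x \/ g x = x) ->
  psi f y <> y -> (psi g ^+ 12) y = y.
Proof.
move=> fg fy; apply: contrapT => g12y.
have gi i : (0 < i <= 4)%N -> (psi g ^+ i) y <> y.
  move=> i4 e; apply: g12y; have -> : 12 = (i * (12 %/ i))%N.
    by case: i i4 {e} => [|[|[|[|[|]]]]].
  by rewrite expgnA; apply: thompson_fixX.
have [N0 HN0] := displaced_nbhd fy.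
have [N1 HN1] := displaced_nbhd (gi 1%N erefl).
have [N2 HN2] := displaced_nbhd (gi 2%N erefl).
have [N3 HN3] := displaced_nbhd (gi 3%N erefl).
have [N4 HN4] := displaced_nbhd (gi 4%N erefl).
pose n := (N0 + N1 + N2 + N3 + N4)%N; pose J := mkseq y n.
have fJ x : starts J x -> ~~ starts J (psi f x).
  by apply: HN0; rewrite /n -!addnA leq_addr.
have gJ i x : (0 < i <= 4)%N -> starts J x -> ~~ starts J ((psi g ^+ i) x).
  case: i => [|[|[|[|[|//]]]]] // _.
  - by apply: HN1; rewrite /n -2!addnA -addnA addnCA leq_addr.
  - by apply: HN2; rewrite /n -addnA -addnA addnCA leq_addr.
  - by apply: HN3; rewrite /n -addnA addnCA leq_addr.
  - by apply: HN4; rewrite /n leq_addl.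
have [f0 [h [_ hJ nc]]] := noncommuting_pair J.
have [x0 hx0] : exists x, h x <> x.
  by apply: thompson_neq1 => h1; apply: nc; rewrite h1; apply: commute1.
have Jx0 : starts J x0 by apply: contra_notT hx0 => /hJ.
have nfh : ~ commute f (psi' h).
  move=> /(morph_commute psiM);
  rewrite psi'K => /(congr1 (fun u : thompsonV => u x0)).
  by rewrite !thompson_mulE (hJ (psi f x0)) ?fJ // => /thompson_inj.
have [f1 [f2 [f1g f2g k1 kg]]] := disjoint_commutators fg nfh.
have {f1g f2g} := (morph_commute psiM f1g, morph_commute psiM f2g).
move: (morph_commute psiM kg); rewrite !(morph_commg psiM) psi'K.
have {k1} : [~ psi f1, [~ psi f2, h]] <> 1.
  rewrite -[h]psi'K -!(morph_commg psiM) -(morph_one psiM).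
  by move=> /(congr1 psi'); rewrite !psiK => /k1.
move: (psi f1) (psi f2) (psi g) gJ => F1 F2 G GJ; set k := [~ F1, _].
move=> k1 kG [F1G F2G]; have [q kq] := thompson_neq1 k1.
(* [k] is a product of four conjugates of [h] and [h^-1]; as [h] is supported in [J], [k] can move a
   point only if one of these four elements takes it into [J]. *)
pose e : 'I_4 -> thompsonV := tnth [tuple 1; F2; F1; F2 * F1].
have eG i : commute (e i) G.
  rewrite /e (tnth_nth 1); case: i => -[|[|[|[|//]]]] //= _.
    exact/commute_sym/commute1.
  by apply/commute_sym/commuteM; apply: commute_sym.
have kJ x : k x <> x -> exists i, starts J (e i x).
  move=> kx; apply: contrapT => /forallNP no; apply: kx.
  have no' i : ~~ starts J (e i x) by apply/negP; exact: no.
  have [n0 n1 n2 n3] : [/\ ~~ starts J x, ~~ starts J (F2 x),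
      ~~ starts J (F1 x) & ~~ starts J (F2 (F1 x))].
    have := (no' (inord 0), no' (inord 1), no' (inord 2), no' (inord 3)).
    by rewrite /e !(tnth_nth 1) !inordK //= => -[[[]]].
  rewrite /k !commgEl !conjgE !invMg !invgK !thompson_mulE.
  rewrite (hJ x n0) (supportedV hJ n1) thompsonK.
  by rewrite (hJ _ n3) thompsonK (supportedV hJ n2) thompsonK.
have kGq i : k ((G ^+ i) q) <> (G ^+ i) q.
  have /(congr1 (fun u : thompsonV => u q)) := commuteX i kG.
  rewrite !thompson_mulE => -> /thompson_inj; exact: kq.
(* Pigeonhole: five translates of [q] are moved by [k], but only four elements are available. Since
   these commute with [G], a power of [G] with exponent between 1 and 4 brings a point of [J] back
   into [J]. *)
have /choice[ee Hee] : forall i : 'I_5, exists j, starts J (e j ((G ^+ i) q)).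
  by move=> i; apply: kJ.
have /injectivePn[i [j neij eij]] : ~~ injectiveb ee.
  by apply/negP => /injectiveP /leq_card; rewrite !card_ord.
wlog ltij : i j neij eij / (i < j)%N.
  move=> W; case: (ltngtP i j) => [/W|/W|/val_inj eqij].
  - exact.
  - by rewrite eq_sym; apply.
  by rewrite eqij eqxx in neij.
have := GJ (j - i)%N _ _ (Hee i); rewrite subn_gt0 ltij leq_subLR.
have -> : (j <= i + 4)%N by apply: leq_trans (leq_addl i 4); rewrite -ltnS ltn_ord.
move=> /(_ isT) /negP[].
have /(congr1 (fun u : thompsonV => u ((G ^+ i) q))) :=
  commuteX (j - i) (eG (ee i)).
rewrite !thompson_mulE => <-; rewrite -(thompson_mulE (G ^+ (j - i))) -expgnDr.
by rewrite subnK ?(ltnW ltij) // eij.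
Qed.

End Transport.

(** * The point of the source over a point of the target *)

(** The words J0, J10, J110, ...: an unlimited supply of disjoint subintervals of [J]. *)
Definition spare (J : word) (k : nat) : word := J ++ rcons (nseq k true) false.

Lemma starts_spare_inj J x k l :
  starts (spare J k) x -> starts (spare J l) x -> k = l.
Proof.
rewrite !starts_cat => /andP[_ +] /andP[_]; move: (shift _ x) => {}x.
wlog ltkl : k l / (k < l)%N.
  move=> W xk xl; case: (ltngtP k l) => [lt|lt|//]; first exact: W lt xk xl.
  by rewrite (W _ _ lt xl xk).
move=> /starts_nth /(_ k) + /starts_nth /(_ k).
rewrite !size_rcons !size_nseq ltnSn ltnS (ltnW ltkl) !nth_rcons !size_nseq.
by rewrite ltnn eqxx ltkl nth_nseq ltkl => -> // /(_ isT).
Qed.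

Lemma exists_thompson_starts y J : exists v : thompsonV, starts J (v y).
Proof.
have [Jy|nJy] := boolP (starts J y); first by exists 1.
pose p := mkseq y (size J); have szp : size p = size J by rewrite size_mkseq.
have pJ x : starts p x -> ~~ starts J x.
  move=> px; apply/negP => Jx; move/negP: nJy; apply.
  by rewrite -(starts_inj_size px Jx szp) starts_mkseq.
have aw := word_pair_antichain pJ.
have [c [_ ad _]] := cycle_exists aw; exists c.
have := ad ord0; rewrite /word_pair /= => e.
by rewrite -(starts_prependK (starts_mkseq y (size J))) e starts_prepend.
Qed.

Section FixedPoints.

Variables psi psi' : thompsonV -> thompsonV.
Hypotheses (psiK : cancel psi psi') (psi'K : cancel psi' psi).
Hypothesis psiM : {morph psi : u v / u * v}.
Variable K : nat.
Hypothesis K12 : (12 %| K.+1)%N.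
Implicit Types (w : 'I_K.+2 -> word) (U W : word -> Prop) (J : word).
Implicit Types (c f g v : thompsonV) (x y z : cantor_space).

(** When [U] consists of the extensions of one word, this says that its interval is not visible from
    [y]. General families [U] accommodate unions of intervals. *)
Definition fixes y U : Prop :=
  forall c w, is_cycle c w -> (forall i, U (w i)) -> psi c y = y.

(** [disjoint_transport] only controls [psi g ^+ 12]; since 12 divides [K.+1] and [g ^+ K.+2 = 1],
    this suffices for [psi g]. *)
Lemma disjoint_cycles_fix f g w w' y : is_cycle f w -> is_cycle g w' ->
  (forall i j x, starts (w i) x -> ~~ starts (w' j) x) ->
  psi f y <> y -> psi g y = y.
Proof.
move=> fw gw' ww' fy.
have fg x : f x = x \/ g x = x.
  case: (pickP (fun i => starts (w i) x)) => [i wi|no].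
    by right; have [_ _ ->] := gw' => // j; apply: ww' wi.
  by left; have [_ _ ->] := fw => // j; rewrite no.
have g12 := disjoint_transport psiK psi'K psiM fg fy.
have /dvdnP[k Kk] := K12.
have {g12} gK : (psi g ^+ K.+1) y = y.
  by rewrite Kk mulnC expgnA; apply: thompson_fixX.
rewrite -{1}gK -thompson_mulE -expgS -(morph_exp psiM) (cycle_order gw').
by rewrite (morph_one psiM).
Qed.

Definition extension_closed U : Prop := forall m s, U m -> U (m ++ s).

(** Each [w i] is long enough to lie inside or off each of the first 2(K+2) spare subwords of [J],
    and it lies inside at most one; so at least K+2 of them stay free. They are padded by [n]
    letters to be long. *)
Lemma free_spares w J n : (forall i, size J + (K.+2 + K.+2) <= size (w i))%N ->
  antichain w ->
  exists u : 'I_K.+2 -> word, [/\ antichain u,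
    forall i, prefix J (u i) /\ (n <= size (u i))%N &
    forall i j x, starts (u i) x -> ~~ starts (w j) x].
Proof.
move=> szw aw; set t := (K.+2 + K.+2)%N in szw.
pose hit := [set k : 'I_t | [exists i, prefix (spare J k) (w i)]].
have szJ (k : 'I_t) i : (size (spare J k) <= size (w i))%N.
  apply: leq_trans (szw i); rewrite size_cat leq_add2l size_rcons size_nseq.
  exact: ltn_ord.
have hitM : (#|hit| <= K.+2)%N.
  have /choice[h hP] : forall k : 'I_t, exists i,
      k \in hit -> prefix (spare J k) (w i).
    move=> k; case: (boolP (k \in hit)); last by exists 0%R.
    by rewrite inE => /existsP[i ki]; exists i.
  rewrite -[X in (_ <= X)%N]card_ord; apply: (leq_card_in h) => k l hk hl hkl.
  have /prefixP[s e] := hP _ hk; have /prefixP[s' e'] := hP _ hl.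
  apply: val_inj; apply: (@starts_spare_inj J (prepend (w (h k)) point)).
    by apply: (@starts_catl _ s); rewrite -e starts_prepend.
  by apply: (@starts_catl _ s'); rewrite -e' hkl starts_prepend.
have freeM : (K.+2 <= #|~: hit|)%N.
  rewrite cardsCs finset.setCK card_ord leq_subRL ?leq_add2r //.
  by rewrite (leq_trans hitM) ?leq_addl.
pose F (i : 'I_K.+2) : 'I_t := enum_val (widen_ord freeM i).
have Fhit i : F i \notin hit by have := enum_valP (widen_ord freeM i); rewrite inE.
exists (fun i => spare J (F i) ++ nseq n false); split.
- apply: antichain_cat => i j x xi xj.
  have /val_inj/enum_val_inj := starts_spare_inj xi xj.
  by move=> /(congr1 val) /= e; apply: val_inj.
- by move=> i; rewrite -catA prefix_prefix !size_cat size_nseq addnA leq_addl.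
move=> i j x /starts_catl ui; apply/negP => wj.
move/negP: (Fhit i); apply; rewrite inE; apply/existsP; exists j.
by rewrite (starts_size ui wj (szJ _ _)) prefix_prefix.
Qed.

(* A cycle in U \/ W is conjugated into U by moving its words one at a time with
   cycles in W whose remaining words are spare subwords of J. *)
Lemma fixes_union y U W J : extension_closed U -> extension_closed W ->
  U J -> W J -> fixes y U -> fixes y W -> fixes y (fun m => U m \/ W m).
Proof.
move=> eU eW UJ WJ fU fW c w cw wUW; set n := (size J + (K.+2 + K.+2))%N.
apply: (cycle_split (n := n) (P := fun c => psi c y = y) cw).
  by move=> u v uy vy; rewrite psiM thompson_mulE vy uy.
move=> s {cw}c sn cw.
move: cw; set ws : 'I_K.+2 -> word := fun i => _.
have szws i : (n <= size (ws i))%N by rewrite size_cat sn leq_addl.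
have {wUW} : forall i, U (ws i) \/ W (ws i).
  by move=> i; case: (wUW i) => [Ui|Wi]; [left; apply: eU|right; apply: eW].
(* Induction on the number of words that are not in [U]. *)
move: ws szws => {w sn s} w; move: {2}#|_| (leqnn #|[pred i | ~~ `[< U (w i) >]]|).
move=> k; elim: k w c => [|k IHk] w c lek szw wUW cw.
  apply: fU cw _ => i; apply: contrapT => nU.
  move: lek; rewrite leqn0 => /eqP/card0_eq/(_ i).
  by rewrite inE; move/asboolP: nU; rewrite asbool_neg => ->.
case: (pickP [pred i | ~~ `[< U (w i) >]]) => [i0 /asboolPn nUi0|no]; last first.
  by apply: fU cw _ => i; apply/asboolP/negbFE; exact: no.
have Wi0 : W (w i0) by case: (wUW i0).
have [aw _ _] := cw; have [u [au uJn uw]] := free_spares n szw aw.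
(* The cycle on [u'] carries the offending word [w i0] to a spare word, so conjugating by it lowers
   the count. All its words lie in [W], so its image under [psi] fixes [y]. *)
pose u' i := if i == 0%R then w i0 else u i.
have au' : antichain u'.
  move=> i j x; rewrite /u'; case: eqP => [->|_]; case: eqP => [->|_] //.
  - by move=> w0 /(uw _ i0); rewrite w0.
  - by move=> /(uw _ i0) /negP.
  exact: au.
have [g gu'] := cycle_exists au'; have [_ gad gid] := gu'.
have WU i : U (u i) /\ W (u i).
  by have [/prefixP[s ->] _] := uJn i; split; [apply: eU|apply: eW].
have gy : psi g y = y.
  by apply: fW gu' _ => i; rewrite /u'; case: ifP => // _; case: (WU i).
have n10 : (1%R == 0%R :> 'I_K.+2) = false by [].
pose w1 i := if i == i0 then u 1%R else w i.
have gw1 i : adapted g (w i) (w1 i).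
  move=> z; rewrite /w1; case: eqP => [->|ni].
    by have := gad 0%R z; rewrite /u' eqxx GRing.add0r n10.
  apply: gid => j; rewrite /u'; case: ifP => _; apply/negP.
    by move=> /(aw _ _ _ (starts_prepend (w i) z)).
  by move=> /(uw _ i); rewrite starts_prepend.
have : psi (g * c * g^-1) y = y.
  apply: IHk (cycle_conj cw gw1).
  - rewrite -ltnS; apply: leq_trans lek; apply: proper_card; apply/properP; split.
      apply/fintype.subsetP => i; rewrite !inE /w1; case: eqP => // _.
      by move=> /asboolPn; case: (WU 1%R).
    exists i0; rewrite !inE /w1 ?eqxx; first exact/asboolPn.
    by rewrite negbK; apply/asboolP; case: (WU 1%R).
  - by move=> i; rewrite /w1; case: ifP => // _; case: (uJn 1%R).
  by move=> i; rewrite /w1; case: ifP => // _; left; case: (WU 1%R).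
rewrite !psiM (morph_inv psiM) !thompson_mulE (thompson_fixV gy) -{2}gy.
exact: thompson_inj.
Qed.

(** Some [psi c] moves a point [q], and a [v] bringing [y] close to [q] gives a conjugate that moves
    [y]. Cutting [c] into cycles with long words makes their conjugates cycles again. *)
Lemma not_fixes_all y : ~ fixes y (fun=> True).
Proof.
move=> fy; have asp : antichain (fun i : 'I_K.+2 => spare [::] i).
  by move=> i j x xi xj; apply/val_inj/(starts_spare_inj xi xj).
have [c cw] := cycle_exists asp.
have [q cq] : exists q, psi c q <> q.
  apply: thompson_neq1; rewrite -(morph_one psiM) => /(can_inj psiK).
  exact: cycle_neq1 cw.
have [N HN] := displaced_nbhd cq; have [v vJ] := exists_thompson_starts y (mkseq q N).
suff e : psi (psi' v^-1 * c * psi' v) y = y.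
  have := HN N (leqnn N) _ vJ; rewrite -{1}(thompsonVK v (psi c (v y))).
  by move: e; rewrite !psiM !psi'K !thompson_mulE => ->; rewrite vJ.
have [n Hn] := prefix_replacing_unif (thompson_funP (psi' v)^-1).
apply: (cycle_split (n := n) (P := fun c => psi (psi' v^-1 * c * psi' v) y = y) cw).
  move=> f g; rewrite !psiM !psi'K !thompson_mulE => ef eg.
  by rewrite -{2}ef -{2}eg thompsonVK.
move=> s c' sn cs; have /choice[w' ad] : forall i : 'I_K.+2, exists m',
    adapted ((psi' v)^-1)%g (spare [::] i ++ s) m'.
  by move=> i; apply: Hn; rewrite size_cat sn leq_addl.
apply: fy (w') _ (fun=> I).
have psi'V : psi' v^-1 = (psi' v)^-1.
  by apply: (can_inj psiK); rewrite (morph_inv psiM) !psi'K.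
rewrite psi'V -[X in _ * X]invgK; exact: cycle_conj cs ad.
Qed.

Definition fixes_at y J : Prop := fixes y (prefix J).

Lemma fixes_disjoint y U W :
  (forall m m' x, U m -> W m' -> starts m x -> ~~ starts m' x) ->
  fixes y U \/ fixes y W.
Proof.
move=> UW; apply/or_asboolP; rewrite -implyNb; apply/implyP => /asboolPn nU.
apply/asboolP => g w' gw' Ww'; apply: contrapT => gy; apply: nU => f w fw Uw.
apply: disjoint_cycles_fix gw' fw _ gy => j i x wj; apply/negP => wi.
by move: (UW _ _ _ (Uw i) (Ww' j) wi); rewrite wj.
Qed.

(** The halves of [J] do not overlap, so they are bridged by [A b], one quarter from each half.
    [A false] and [A true] are disjoint, so one of them is not visible from [y], and [fixes_union]
    applies twice. *)
Lemma fixes_at_split y J : fixes_at y (rcons J false) ->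
  fixes_at y (rcons J true) -> fixes_at y J.
Proof.
move=> f0 f1.
pose A b m := prefix (J ++ [:: false; b]) m \/ prefix (J ++ [:: true; b]) m.
have pc s t : prefix (J ++ s) (J ++ t) = prefix s t by rewrite prefix_catr // eqxx.
have eP p : extension_closed (prefix p) by move=> m s; apply: prefix_catl.
have eA b : extension_closed (A b).
  by move=> m s [mA|mA]; [left|right]; apply: prefix_catl.
have [b fA] : exists b, fixes y (A b).
  have [fA|fA] : fixes y (A false) \/ fixes y (A true); last by exists true.
    have AE b m x : A b m -> starts m x -> shift (size J) x 1%N = b.
      by case=> /prefixP[s ->] /starts_catl;
        rewrite starts_cat => /andP[_ /starts_nth/(_ 1%N erefl)].
    apply: fixes_disjoint => m m' x /AE Am /AE Am' /Am mx.
    by apply/negP => /Am'; rewrite mx.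
  by exists false.
have f01 : fixes y (fun m =>
    (A b m \/ prefix (rcons J false) m) \/ prefix (rcons J true) m).
  apply: (@fixes_union y _ _ (J ++ [:: true; b])) => //.
  - by move=> m s [mA|mA]; [left; apply: eA|right; apply: eP].
  - by left; right; rewrite prefix_refl.
  - by rewrite -cats1 pc.
  apply: (@fixes_union y _ _ (J ++ [:: false; b])) => //.
  - by left; rewrite prefix_refl.
  - by rewrite -cats1 pc.
move=> c w cw Jw; have [c0 [c1 [cw0 cw1 ->]]] := cycle_split1 cw.
have Jr i d : (A b (rcons (w i) d) \/ prefix (rcons J false) (rcons (w i) d)) \/
    prefix (rcons J true) (rcons (w i) d).
  have /prefixP[s ->] := Jw i; rewrite rcons_cat -!cats1.
  rewrite /A !pc; case: s => [|[] s] /=; rewrite ?prefix0s.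
  - by case: d; [right|left; right].
  - by right.
  - by left; right.
by rewrite psiM thompson_mulE (f01 _ _ cw1) // (f01 _ _ cw0).
Qed.

(** Bisection from the whole space: by [fixes_at_split] a visible interval has a visible half, and
    [step] takes the right one whenever it is visible. *)
Lemma fixes_point y : exists x, forall n, ~ fixes_at y (mkseq x n).
Proof.
pose step J := rcons J `[< ~ fixes_at y (rcons J true) >].
pose x : cantor_space := fun n =>
  `[< ~ fixes_at y (rcons (iter n step [::]) true) >].
exists x => n; have -> : mkseq x n = iter n step [::].
  by elim: n => // n IHn; rewrite mkseqS IHn.
elim: n => [|n IHn] /=.
  move=> f; apply: (@not_fixes_all y) => c w cw _; apply: f cw _ => i.
  exact: prefix0s.
rewrite /step; case: asboolP => // /contrapT f1 f0.
exact/IHn/fixes_at_split.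
Qed.

(** A cycle in an interval around [x] disjoint from [J] has an image moving [y], hence every point
    near [y]; [disjoint_cycles_fix] applies at each of these points. *)
Lemma fixes_nbhd x y c w J : (forall n, ~ fixes_at y (mkseq x n)) ->
  is_cycle c w -> (forall i, prefix J (w i)) -> ~~ starts J x ->
  exists N, forall z, starts (mkseq y N) z -> psi c z = z.
Proof.
move=> nf cw Jw nJx.
have [f [u [fu xu fy]]] : exists f (u : 'I_K.+2 -> word), [/\ is_cycle f u,
    forall i, prefix (mkseq x (size J)) (u i) & psi f y <> y].
  apply: contrapT => no; apply: (nf (size J)) => f u fu xu.
  by apply: contrapT => fy; apply: no; exists f, u.
have [N HN] := displaced_nbhd fy; exists N => z yz.
apply: (disjoint_cycles_fix fu cw) => [i j t ui|fz]; last first.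
  by have := HN N (leqnn N) z yz; rewrite fz yz.
have /prefixP[s us] := xu i; apply/negP => wj; have /prefixP[s' ws] := Jw j.
move/negP: nJx; apply; rewrite us in ui; rewrite ws in wj.
rewrite -(starts_inj_size (starts_catl ui) (starts_catl wj)) ?size_mkseq //.
exact: starts_mkseq.
Qed.

End FixedPoints.

(** * Fraction groups *)

Lemma adapted_starts (v : thompsonV) p p' x : adapted v p p' ->
  starts p' (v x) = starts p x.
Proof.
move=> ad; apply/idP/idP => /starts_prependK e; last first.
  by rewrite -e ad starts_prepend.
by rewrite -(thompsonK v x) -e -ad thompsonK starts_prepend.
Qed.

Lemma spare_antichain K J : antichain (fun i : 'I_K => spare J i).
Proof. by move=> i j x xi xj; apply/val_inj/(starts_spare_inj xi xj). Qed.

Section AutT.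

Variables (gT : finGroupType) (s : {perm gT}).
Hypothesis As : s \in Aut [set: gT].

Lemma AutT_M : {morph s : g h / g * h}.
Proof. by move=> g h; rewrite (morphicP (Aut_morphic As)) ?inE. Qed.

End AutT.

Section LocallyConstant.

Variable gT : finGroupType.
Implicit Types (a b : LGamma gT) (g h : gT) (p : word).

Lemma loc_expE a n x : (a ^+ n) x = a x ^+ n.
Proof. by elim: n => // n IHn; rewrite !expgS loc_mulE IHn. Qed.

Lemma loc_exp_card a : a ^+ #|gT| = 1.
Proof.
apply: loc_eq => x; rewrite loc_expE -cardsT.
by apply: (@expg_cardG _ [set: gT]%G); rewrite inE.
Qed.

Fact loc_restrict_subproof a p :
  locally_constant (fun x => if starts p x then a x else 1).
Proof.
have /locally_constant_unif[N HN] := loc_funP a.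
apply/locally_constant_unif; exists (maxn N (size p)) => m.
rewrite geq_max => /andP[leN lep] x y.
by rewrite (starts_deep x y lep) (HN m leN x y).
Qed.

Definition loc_restrict a p : LGamma gT := LocConst (loc_restrict_subproof a p).

Fact loc_const_subproof g : locally_constant (fun _ : cantor_space => g).
Proof. by apply/locally_constant_unif; exists 0%N. Qed.

Definition loc_const g : LGamma gT := LocConst (loc_const_subproof g).

Lemma loc_constM : {morph loc_const : g h / g * h}.
Proof. by move=> g h; apply: loc_eq. Qed.

Lemma starts_rcons p (b : bool) x :
  starts (rcons p b) x = starts p x && (x (size p) == b).
Proof.
rewrite -cats1 starts_cat; congr (_ && _).
by rewrite /starts /= eqseq_cons andbT /shift addn0.
Qed.

Lemma loc_restrict_split a p :
  loc_restrict a p = loc_restrict a (rcons p false) * loc_restrict a (rcons p true).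
Proof.
apply: loc_eq => x; rewrite loc_mulE /= !starts_rcons.
by case: (starts p x) (x (size p)) => [] [] /=; rewrite ?mulg1 ?mul1g.
Qed.

Lemma loc_restrict_nil a : loc_restrict a [::] = a.
Proof. by apply: loc_eq. Qed.

End LocallyConstant.

Section Elements.

Variables (gT : finGroupType) (a1 : {perm gT}) (Aa1 : a1 \in Aut [set: gT]).
Local Notation G := (@fraction_group gT 1 a1 (group1 _) Aa1).
Implicit Types (a b : LGamma gT) (u v : thompsonV) (g : G).

Definition frac_loc a : G := FracElt (group1 _) Aa1 a 1.
Definition frac_thompson v : G := FracElt (group1 _) Aa1 1 v.

Lemma frac_LM g h : frac_L (g * h) = frac_L g * jones 1 a1 (frac_V g) (frac_L h).
Proof. by []. Qed.

Lemma frac_VM : {morph (fun g : G => frac_V g) : g h / g * h}.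
Proof. by []. Qed.

Lemma frac_VV g : frac_V g^-1 = (frac_V g)^-1.
Proof. by []. Qed.

Lemma frac_VX g n : frac_V (g ^+ n) = frac_V g ^+ n.
Proof. exact: (morph_exp frac_VM). Qed.

Lemma frac_eta g : frac_V g = 1 -> g = frac_loc (frac_L g).
Proof. by case: g => a v /= ->. Qed.

Lemma frac_locM : {morph frac_loc : a b / a * b}.
Proof. by move=> a b; congr FracElt; rewrite /= ?jones1 ?mulg1. Qed.

Lemma frac_loc1 : frac_loc 1 = 1.
Proof. by []. Qed.

Lemma frac_locX a n : frac_loc (a ^+ n) = frac_loc a ^+ n.
Proof. exact: (morph_exp frac_locM). Qed.

Lemma frac_thompsonM : {morph frac_thompson : u v / u * v}.
Proof. by move=> u v; congr FracElt; rewrite /= jones_one ?mulg1 ?group1. Qed.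

Lemma frac_decomp g : g = frac_loc (frac_L g) * frac_thompson (frac_V g).
Proof. by case: g => a v; congr FracElt; rewrite /= ?jones1 ?mulg1 ?mul1g. Qed.

Lemma frac_conj v a :
  frac_thompson v * frac_loc a = frac_loc (jones 1 a1 v a) * frac_thompson v.
Proof. by congr FracElt; rewrite /= ?jones1 ?mulg1 ?mul1g. Qed.

(* Normalising by [alpha_word p] makes these elements equivariant: see
   [jones_single]. *)
Definition single (g : gT) (p : word) : LGamma gT :=
  loc_restrict (loc_const ((alpha_word 1 a1 p)^-1 g)) p.

Lemma jones_single v p p' (g : gT) : adapted v p p' ->
  jones 1 a1 v (single g p) = single g p'.
Proof.
move=> ad; apply: (@jones_ext _ v) => x; rewrite jonesE /= (adapted_starts _ ad).
case: ifP => px; last first.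
  by rewrite (morph_one (AutT_M (tau_Aut (group1 _) Aa1 v x))).
by rewrite (tauE 1 a1 (m := p) (m' := p')) //; [rewrite permM permKV|exact/sdiP].
Qed.

Lemma alpha_word_rcons (a0 : {perm gT}) p (l : bool) :
  alpha_word a0 a1 (rcons p l) = alpha_word a0 a1 p * (if l then a1 else a0).
Proof. by rewrite /alpha_word big_rcons. Qed.

(** As alpha_0 is the identity, the left half keeps the label [g]; the right half absorbs one [a1]
    into its normalisation. *)
Lemma single_split (g : gT) p :
  single g p = single g (rcons p false) * single (a1 g) (rcons p true).
Proof.
rewrite /single loc_restrict_split.
congr (loc_restrict (loc_const _) _ * loc_restrict (loc_const _) _).
  by rewrite alpha_word_rcons mulg1.
by rewrite alpha_word_rcons invMg permM permK.
Qed.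

End Elements.

(** * Isomorphisms of fraction groups *)

Section Homomorphism.

Variables (gT rT : finGroupType) (a1 : {perm gT}) (b1 : {perm rT}).
Variables (Aa1 : a1 \in Aut [set: gT]) (Ab1 : b1 \in Aut [set: rT]).
Local Notation G := (@fraction_group gT 1 a1 (group1 _) Aa1).
Local Notation H := (@fraction_group rT 1 b1 (group1 _) Ab1).
Variables (th : G -> H) (th' : H -> G).
Hypotheses (thK : cancel th th') (th'K : cancel th' th).
Hypothesis thM : {morph th : g h / g * h}.
Implicit Types (a b : LGamma gT) (u v : thompsonV) (x y z : cantor_space).

(* The normal subgroup [th LGamma] has exponent dividing [#|gT|]; were its image
   in V nontrivial, commutators [v, u] with [u] a long cycle in a small interval
   would violate this. *)
Lemma iso_loc a : frac_V (th (frac_loc Aa1 a)) = 1.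
Proof.
apply: contrapT => /thompson_neq1; set v := frac_V _ => -[x vx].
have [N /(_ N (leqnn N))] := displaced_nbhd vx; set J := mkseq x N => vJ.
(* The cycle length [K.+2] is then [#|gT| + 1], so [u ^+ #|gT|] cannot be trivial. *)
have [K Kcard] : exists K, K.+1 = #|gT|.
  by exists #|gT|.-1; rewrite prednK // -cardsT cardG_gt0.
have [u uw] := cycle_exists (@spare_antichain K.+2 J).
have uJ : supported u J by apply: cycle_supported uw _ => i; exact: prefix_prefix.
set b := th' (frac_thompson Ab1 u).
set g := frac_loc Aa1 a * b * (frac_loc Aa1 a)^-1 * b^-1.
have gX : g ^+ #|gT| = 1.
  have /frac_eta -> : frac_V g = 1.
    by rewrite /g !frac_VM !frac_VV mul1g invg1 mulg1 mulgV.
  by rewrite -frac_locX loc_exp_card frac_loc1.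
have : frac_V (th g) ^+ #|gT| = 1.
  by rewrite -frac_VX -(morph_exp thM) gX (morph_one thM).
rewrite /g !thM !(morph_inv thM) !frac_VM !frac_VV -/v th'K /=.
(* The image of [g] in V is [v * u * v^-1] times [u^-1], with supports off and in [J]; if a power of
   the product is trivial, so is that power of [u]. *)
have kJ z : starts J z -> (v * u * v^-1) z = z.
  move=> Jz; rewrite !thompson_mulE uJ ?thompsonVK //.
  by apply/negP => /vJ; rewrite thompsonVK Jz.
rewrite expgMn; last first.
  by apply: commuteV; apply: commute_sym; exact: supported_commute uJ kJ.
rewrite expVgn => /divg1_eq kX; apply: (cycle_neq1 uw).
suff uX : u ^+ K.+1 = 1 by rewrite -[u]mulg1 -uX -expgS (cycle_order uw).
rewrite Kcard; apply: thompson_eq => z; rewrite thompson1E.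
have [Jz|nJz] := boolP (starts J z); last by rewrite thompson_fixX ?uJ.
by rewrite -kX thompson_fixX ?kJ.
Qed.

(** By [iso_loc] this is the map that [th] induces modulo the locally constant functions, the psi of
    the overview. *)
Definition iso_V v : thompsonV := frac_V (th (frac_thompson Aa1 v)).

Lemma iso_VM : {morph iso_V : u v / u * v}.
Proof. by move=> u v; rewrite /iso_V frac_thompsonM thM. Qed.

Definition kappa a : LGamma rT := frac_L (th (frac_loc Aa1 a)).

Lemma kappaE a : th (frac_loc Aa1 a) = frac_loc Ab1 (kappa a).
Proof. exact/frac_eta/iso_loc. Qed.

Lemma kappaM : {morph kappa : a b / a * b}.
Proof. by move=> a b; rewrite /kappa frac_locM thM !kappaE -frac_locM. Qed.

Definition cocycle v : LGamma rT := frac_L (th (frac_thompson Aa1 v)).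

Lemma th_thompsonE v :
  th (frac_thompson Aa1 v) = frac_loc Ab1 (cocycle v) * frac_thompson Ab1 (iso_V v).
Proof. exact: frac_decomp. Qed.

Lemma cocycleM u v : cocycle (u * v) = cocycle u * jones 1 b1 (iso_V u) (cocycle v).
Proof. by rewrite /cocycle frac_thompsonM thM. Qed.

(** Apply [th] to [frac_conj]. Conjugation by the cocycle is the source of the inner automorphism in
    the final relation. *)
Lemma kappa_conj v a y :
  kappa (jones 1 a1 v a) (iso_V v y) =
  cocycle v (iso_V v y) * tau 1 b1 (iso_V v) y (kappa a y) *
    (cocycle v (iso_V v y))^-1.
Proof.
have := congr1 (fun h : G => frac_L (th h)) (frac_conj Aa1 v a).
rewrite !thM kappaE kappaE !frac_LM -/(cocycle v) -/(iso_V v) /= jones1.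
move=> /(congr1 (fun c : LGamma rT => c (iso_V v y))).
rewrite !loc_mulE jonesE => ->; by rewrite mulgK.
Qed.

End Homomorphism.

Section Isomorphism.

Variables (gT rT : finGroupType) (a1 : {perm gT}) (b1 : {perm rT}).
Variables (Aa1 : a1 \in Aut [set: gT]) (Ab1 : b1 \in Aut [set: rT]).
Local Notation G := (@fraction_group gT 1 a1 (group1 _) Aa1).
Local Notation H := (@fraction_group rT 1 b1 (group1 _) Ab1).
Variables (th : G -> H) (th' : H -> G).
Hypotheses (thK : cancel th th') (th'K : cancel th' th).
Hypothesis thM : {morph th : g h / g * h}.
Implicit Types (a b : LGamma gT) (u v : thompsonV) (x y z : cantor_space).

Lemma iso_inverse_M : {morph th' : g h / g * h}.
Proof. by move=> g h; apply: (can_inj thK); rewrite thM !th'K. Qed.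

Let th'M := iso_inverse_M.

Lemma iso_VK : cancel (iso_V th) (iso_V th').
Proof.
move=> v; have := th_thompsonE th v => /(congr1 (fun h => frac_V (th' h))).
by rewrite thK th'M frac_VM (iso_loc thK th'M) mul1g => e; exact: esym e.
Qed.

Lemma kappaK : cancel (kappa th) (kappa th').
Proof.
by move=> a; rewrite /kappa -(kappaE th'K thM) thK.
Qed.

End Isomorphism.

(** * Locality: values at [y] are governed by a single source point *)

Section Points.

Variables (gT rT : finGroupType) (a1 : {perm gT}) (b1 : {perm rT}).
Variables (Aa1 : a1 \in Aut [set: gT]) (Ab1 : b1 \in Aut [set: rT]).
Local Notation G := (@fraction_group gT 1 a1 (group1 _) Aa1).
Local Notation H := (@fraction_group rT 1 b1 (group1 _) Ab1).
Variables (th : G -> H) (th' : H -> G).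
Hypotheses (thK : cancel th th') (th'K : cancel th' th).
Hypothesis thM : {morph th : g h / g * h}.
Implicit Types (a b : LGamma gT) (u v : thompsonV) (x y z : cantor_space).

Let psiK : cancel (iso_V th) (iso_V th') := iso_VK thK th'K thM.
Let psi'K : cancel (iso_V th') (iso_V th) :=
  iso_VK th'K thK (iso_inverse_M thK th'K thM).
Let psiM := iso_VM thM.
Let kM := kappaM th'K thM.

Section Trivial.

Variable K : nat.
Hypotheses (K12 : (12 %| K.+1)%N) (KrT : (#|rT| %| K.+1)%N).
Variables x y : cantor_space.
Hypothesis yx : forall n, ~ fixes_at (iso_V th) K y (mkseq x n).

(** As [iso_V th c] is trivial near [y], powers of [c] give powers of its cocycle value at [y]. The
    order of that value divides both [K.+2] and [#|rT|], a divisor of [K.+1], so the value is 1. *)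
Lemma kappa_cycle c (w : 'I_K.+2 -> word) p a : is_cycle c w ->
  (forall i, prefix p (w i)) -> ~~ starts p x ->
  kappa th (jones 1 a1 c a) y = kappa th a y.
Proof.
move=> cw pw npx; have [N HN] := fixes_nbhd psiK psi'K psiM K12 yx cw pw npx.
have cy := HN y (starts_mkseq y N).
have tau1 : tau 1 b1 (iso_V th c) y = 1.
  rewrite (tauE 1 b1 (m := mkseq y N) (m' := mkseq y N)) ?mulgV //.
    exact/sdiP/starts_mkseq.
  by move=> z; apply: HN; exact: starts_prepend.
have := kappa_conj th'K thM c a y; rewrite cy tau1 perm1 => ->.
suff -> : cocycle th c y = 1 by rewrite invg1 mulg1 mul1g.
have cX n : cocycle th (c ^+ n) y = cocycle th c y ^+ n.
  elim: n => [|n IHn]; first by rewrite /cocycle (morph_one thM).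
  rewrite expgS (cocycleM thM) loc_mulE expgS; congr (_ * _).
  by rewrite -{1}cy jonesE tau1 perm1 IHn.
have := cX K.+2; rewrite (cycle_order cw) -[1 in LHS](expg0 c) cX expg0 expgS.
have /dvdnP[k ->] := KrT; rewrite mulnC expgnA -cardsT.
by rewrite (@expg_cardG _ [set: rT]%G) ?inE // expg1n mulg1 => <-.
Qed.

(** A cycle carrying [s] to [t] is completed by spare words in the other half of [p], which is why
    [s] and [t] share the half [l]. *)
Lemma kappa_single_eq p l s t (g : gT) : ~~ starts p x ->
  prefix (rcons p l) s -> prefix (rcons p l) t ->
  (forall z, starts s z -> ~~ starts t z) ->
  kappa th (single a1 g s) y = kappa th (single a1 g t) y.
Proof.
move=> npx pls plt st.
pose w (i : 'I_K.+2) := if i == 0%R then s else if i == 1%R then t else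
  spare (rcons p (~~ l)) i.
have lspare r z k : prefix (rcons p l) r -> starts r z ->
    ~~ starts (spare (rcons p (~~ l)) k) z.
  move=> /prefixP[r' ->] /starts_catl; rewrite starts_rcons => /andP[_ /eqP zl].
  by apply/negP => /starts_catl; rewrite starts_rcons zl; case: (l); rewrite andbF.
have aw : antichain w.
  move=> i j z; rewrite /w; case: (eqVneq i 0%R) => [->|i0].
    case: (eqVneq j 0%R) => [->//|j0]; case: ifP => _ sz.
      by move: (st _ sz) => /negbTE ->.
    by move: (lspare _ _ j pls sz) => /negbTE ->.
  case: (eqVneq i 1%R) => [->|i1] iz; case: (eqVneq j 0%R) => [->|j0].
  - by move=> /st; rewrite iz.
  - case: (eqVneq j 1%R) => [->//|j1].
    by move: (lspare _ _ j plt iz) => /negbTE ->.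
  - by move=> /(lspare _ _ i pls); rewrite iz.
  case: (eqVneq j 1%R) => [->|j1]; first by move=> /(lspare _ _ i plt); rewrite iz.
  by move=> jz; apply/val_inj/(starts_spare_inj iz jz).
have [c cw] := cycle_exists aw; have [_ /(_ 0%R) + _] := cw.
rewrite /w GRing.add0r eqxx /= => ad.
rewrite -(jones_single Aa1 g ad); apply/esym/(kappa_cycle _ cw _ npx) => i.
rewrite /w; case: ifP => _; last case: ifP => _.
- by have /prefixP[r ->] := pls; rewrite cat_rcons prefix_prefix.
- by have /prefixP[r ->] := plt; rewrite cat_rcons prefix_prefix.
by rewrite /spare cat_rcons prefix_prefix.
Qed.

Lemma kappa_single p (g : gT) : ~~ starts p x -> kappa th (single a1 g p) y = 1.
Proof.
move=> npx.
have sib q z : starts (rcons q false) z -> ~~ starts (rcons q true) z.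
  by rewrite !starts_rcons => /andP[-> /eqP ->].
have sib' q s z : starts (rcons q true) z -> ~~ starts (rcons (rcons q false) s) z.
  rewrite !starts_rcons => /andP[-> /eqP ->] //.
have half l h : kappa th (single a1 h (rcons p l)) y = 1.
  set q := rcons p l; have pq s t : prefix (rcons p l) (rcons (rcons q s) t).
    by rewrite (prefix_trans (prefix_rcons q s)) // prefix_rcons.
  have e01 h' : kappa th (single a1 h' (rcons q false)) y =
      kappa th (single a1 h' (rcons q true)) y.
    by apply: (kappa_single_eq _ npx) (sib q); apply: prefix_rcons.
  have e1 s h' : kappa th (single a1 h' (rcons q true)) y =
      kappa th (single a1 h' (rcons (rcons q false) s)) y.
    by apply: (kappa_single_eq _ npx _ (pq _ _)) (sib' q s); apply: prefix_rcons.
  (* Splitting [rcons q false] shows that the value for [a1^-1 h'] times the value for [h'] equals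
     the value for [a1^-1 h']. *)
  have z1 h' : kappa th (single a1 h' (rcons q true)) y = 1.
    have := e01 (a1^-1 h'); rewrite single_split kM loc_mulE -!e1 permKV.
    by rewrite -[RHS]mulg1 => /mulgI.
  by rewrite single_split kM loc_mulE e01 !z1 mulg1.
by rewrite single_split kM loc_mulE !half mulg1.
Qed.

Lemma kappa_trivial a : a x = 1 -> kappa th a y = 1.
Proof.
move=> ax; have /locally_constant_unif[N HN] := loc_funP a.
rewrite -[a]loc_restrict_nil.
(* Halve until [a] is constant on each piece: pieces off [x] are covered by [kappa_single], and on
   the piece containing [x] the constant is [a x = 1]. *)
suff H k p : (N <= size p + k)%N -> kappa th (loc_restrict a p) y = 1.
  by apply: (H N); rewrite add0n.
elim: k p => [|k IHk] p; last first.
  move=> le; rewrite loc_restrict_split kM loc_mulE !IHk ?mulg1 //.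
    by rewrite size_rcons addSnnS.
  by rewrite size_rcons addSnnS.
rewrite addn0 => le; have [px|npx] := boolP (starts p x).
  have -> : loc_restrict a p = 1; last by rewrite /kappa frac_loc1 (morph_one thM).
  apply: loc_eq => z /=; case: ifP => // /starts_prependK <-.
  by rewrite (HN p le _ (shift (size p) x)) starts_prependK.
rewrite -(kappa_single (alpha_word 1 a1 p (a (prepend p point))) npx).
congr (kappa th _ y); apply: loc_eq => z /=; case: ifP => // pz.
by rewrite permK -{1}(starts_prependK pz) (HN p le _ point).
Qed.

End Trivial.

Lemma kappa_point y : exists x, forall a, a x = 1 -> kappa th a y = 1.
Proof.
(* The factor 12 serves [disjoint_transport], the factor [#|rT|] kills the cocycle in
   [kappa_cycle]. *)
have [K Kcard] : exists K, K.+1 = (12 * #|rT|)%N.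
  by exists (12 * #|rT|).-1; rewrite prednK // muln_gt0 /= -cardsT cardG_gt0.
have K12 : (12 %| K.+1)%N by rewrite Kcard dvdn_mulr.
have KrT : (#|rT| %| K.+1)%N by rewrite Kcard dvdn_mull.
have [x yx] := fixes_point psiK psi'K psiM K12 y.
by exists x => a; exact: (kappa_trivial K12 KrT yx).
Qed.

End Points.

Definition ones : cantor_space := fun=> true.

(** [c] takes 11 to 0 and [d] takes 0 to 1. At [ones] the resulting tau is alpha_1^2 alpha_1^-1 =
    alpha_1. *)
Lemma thompson_ones :
  exists v : thompsonV, v ones = ones /\ adapted v [:: true; true] [:: true].
Proof.
have c_ok x : starts [:: true; true] x -> ~~ starts [:: false] x.
  move=> /starts_nth /(_ 0%N erefl) x0.
  by apply/negP => /starts_nth /(_ 0%N erefl); rewrite x0.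
have d_ok x : starts [:: false] x -> ~~ starts [:: true] x.
  move=> /starts_nth /(_ 0%N erefl) x0.
  by apply/negP => /starts_nth /(_ 0%N erefl); rewrite x0.
have [c [_ /(_ ord0) cad _]] := cycle_exists (word_pair_antichain c_ok).
have [d [_ /(_ ord0) dad _]] := cycle_exists (word_pair_antichain d_ok).
have ad : adapted (d * c) [:: true; true] [:: true].
  move=> z; rewrite thompson_mulE; have := cad z.
  by rewrite /word_pair /= => ->; exact: dad.
exists (d * c); split=> //.
have onesE p : all id p -> prepend p ones = ones.
  move=> pT; apply/funext => i; rewrite /prepend /ones; case: ifP => // lti.
  by move/(all_nthP false): pT => /(_ _ lti).
by rewrite -{1}(onesE [:: true; true]) // ad onesE.
Qed.

(** * Fibre homomorphisms *)

Section PointHom.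

Variables (gT rT : finGroupType) (a1 : {perm gT}) (b1 : {perm rT}).
Variables (Aa1 : a1 \in Aut [set: gT]) (Ab1 : b1 \in Aut [set: rT]).
Local Notation G := (@fraction_group gT 1 a1 (group1 _) Aa1).
Local Notation H := (@fraction_group rT 1 b1 (group1 _) Ab1).
Variables (th : G -> H) (th' : H -> G).
Hypotheses (thK : cancel th th') (th'K : cancel th' th).
Hypothesis thM : {morph th : g h / g * h}.
Implicit Types (a b : LGamma gT) (u v : thompsonV) (x y z : cantor_space).

Let kM := kappaM th'K thM.

Definition over y x : Prop := forall a, a x = 1 -> kappa th a y = 1.

Definition fiber_hom y (g : gT) : rT := kappa th (loc_const g) y.

Lemma fiber_homM y : {morph fiber_hom y : g h / g * h}.
Proof. by move=> g h; rewrite /fiber_hom loc_constM kM. Qed.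

Lemma kappa_fiber y x a : over y x -> kappa th a y = fiber_hom y (a x).
Proof.
move=> yx; rewrite -{1}[a](mulgKV (loc_const (a x))) kM loc_mulE yx ?mul1g //.
by rewrite loc_mulE /= mulgV.
Qed.

Lemma kappa_surj y h : exists a, kappa th a y = h.
Proof.
exists (kappa th' (loc_const h)).
by rewrite (kappaK th'K thK (iso_inverse_M thK th'K thM)).
Qed.

Lemma fiber_hom_surj y h : exists g, fiber_hom y g = h.
Proof.
have [x yx] := kappa_point thK th'K thM y; have [a <-] := kappa_surj y h.
by exists (a x); rewrite (kappa_fiber _ yx).
Qed.

Lemma fiber_card : (#|rT| <= #|gT|)%N.
Proof.
have /choice[s sK] := fiber_hom_surj ones.
exact: leq_card (can_inj sK).
Qed.

Lemma separate x x' : x <> x' -> exists p, starts p x /\ ~~ starts p x'.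
Proof.
move=> xx'; apply: contrapT => /forallNP no; apply: xx'; apply/funext => i.
have /not_andP[//|/negP/negPn] := no (mkseq x i.+1); first by rewrite starts_mkseq.
by move=> /starts_nth /(_ i); rewrite size_mkseq nth_mkseq // => ->.
Qed.

(** Cutting along an interval that contains only one of two such points would make [kappa th a y]
    trivial for every [a], against surjectivity. *)
Lemma over_unique y x x' : (exists h : rT, h != 1) ->
  over y x -> over y x' -> x = x'.
Proof.
move=> [h h1] yx yx'; apply: contrapT => /separate[p [px px']].
have [a ka] := kappa_surj y h; move/eqP: h1; apply; rewrite -ka.
rewrite -[a](mulKVg (loc_restrict a p)) kM loc_mulE yx' ?yx ?mulg1 //.
  by rewrite loc_mulE /= px mulVg.
by rewrite /= (negbTE px').
Qed.

Lemma over_equivariant y x v : over y x -> over (iso_V th v y) (v x).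
Proof.
move=> yx b bvx; pose a := jones 1 a1 v^-1 b.
have bE : b = jones 1 a1 v a by rewrite -jonesM mulgV jones1.
rewrite bE (kappa_conj th'K thM) yx.
  by rewrite (morph_one (AutT_M (tau_Aut (group1 _) Ab1 _ _))) mulg1 mulgV.
apply: (@perm_inj _ (tau 1 a1 v x)).
by rewrite (morph_one (AutT_M (tau_Aut (group1 _) Aa1 _ _))) -jonesE -bE.
Qed.

Lemma tau_cycle v y : exists n, tau 1 b1 v y = b1 ^+ n.
Proof.
apply/cycleP; rewrite /tau groupM ?groupV //.
all: by rewrite /alpha_word; apply: group_prod => -[] _; rewrite ?cycle_id ?group1.
Qed.

End PointHom.

(** * The relation between [a1] and [b1] *)

Section MainRelation.

Variables (gT rT : finGroupType) (a1 : {perm gT}) (b1 : {perm rT}).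
Variables (Aa1 : a1 \in Aut [set: gT]) (Ab1 : b1 \in Aut [set: rT]).
Local Notation G := (@fraction_group gT 1 a1 (group1 _) Aa1).
Local Notation H := (@fraction_group rT 1 b1 (group1 _) Ab1).
Variables (th : G -> H) (th' : H -> G).
Hypotheses (thK : cancel th th') (th'K : cancel th' th).
Hypothesis thM : {morph th : g h / g * h}.
Let th'M := iso_inverse_M thK th'K thM.

(** Let [y] be the point that [th'] assigns to [ones]. As [kappa th'] inverts [kappa th], the point
    assigned to [y] is [ones] again; equivariance and uniqueness then make [y] fixed. *)
Lemma over_ones : (exists g : gT, g != 1) -> (exists h : rT, h != 1) ->
  exists y, over th y ones /\
    forall v : thompsonV, v ones = ones -> iso_V th v y = y.
Proof.
move=> [g g1] rT1; have [y xy] := kappa_point th'K thK th'M ones.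
have [x yx] := kappa_point thK th'K thM y.
have xE : x = ones.
  apply: contrapT => /nesym/separate[p [p1 px]].
  move/eqP: g1; apply; rewrite -[g]/(loc_const g ones).
  have := kappaK thK th'K thM (loc_restrict (loc_const g) p).
  move=> /(congr1 (fun a : LGamma gT => a ones)) /=; rewrite p1 => <-.
  by apply/xy/yx; rewrite /= (negbTE px).
exists y; split=> [|v v1]; first by rewrite -xE.
apply: (over_unique th'K thK th'M (ex_intro _ g g1) _ xy).
have := over_equivariant thK th'M (v := iso_V th v) xy.
by rewrite (iso_VK thK th'K thM) v1.
Qed.

Lemma fraction_iso_relation : exists (beta : gT -> rT) (beta' : rT -> gT),
  [/\ cancel beta beta', cancel beta' beta, {morph beta : g h / g * h}
    & exists h n, forall g, beta (a1 g) = ad h ((b1 ^+ n) (beta g))].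
Proof.
(* The fibre homomorphisms of [th] and [th'] are surjective, so the orders agree and each of them is
   bijective. *)
have card_eq : #|gT| = #|rT|.
  apply/eqP; rewrite eqn_leq.
  by rewrite (fiber_card thK th'K thM) (fiber_card th'K thK th'M).
have [gT1|/forallNP gT1] := EM (exists g : gT, g != 1); last first.
  have g1 g : g = 1 :> gT by apply/eqP/negPn/negP/gT1.
  have h1 h : h = 1 :> rT.
    have : (#|rT| <= 1)%N.
      by rewrite -card_eq; apply/card_le1_eqP => g g' _ _; rewrite (g1 g) (g1 g').
    by move=> /card_le1_eqP; apply.
  exists (fun=> 1), (fun=> 1); split=> [g|h|g h|]; rewrite ?mulg1 //.
  by exists 1, 0%N => g; rewrite [RHS]h1.
have rT1 : exists h : rT, h != 1.
  have [g g1] := gT1; apply: contrapT => /forallNP no.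
  have : (#|gT| <= 1)%N.
    rewrite card_eq; apply/card_le1_eqP => h h' _ _.
    by have /negP/negPn/eqP-> := no h; have /negP/negPn/eqP-> := no h'.
  by move=> /card_le1_eqP e; move/eqP: g1; apply; apply: e.
have [y [y1 yfix]] := over_ones gT1 rT1.
have /choice[s sK] := fiber_hom_surj thK th'K thM y.
have [t sKt tKs] : bijective s.
  by apply: inj_card_bij (can_inj sK) _; rewrite card_eq.
have fK : cancel (fiber_hom th y) s by move=> g; rewrite -{1}(tKs g) sK tKs.
exists (fiber_hom th y), s; split=> //; first exact: (fiber_homM th'K thM).
(* At [ones] the tau of [v] is [a1], and the image of [v] fixes [y]; [kappa_conj] on constant
   functions gives the relation. *)
have [v [v1 vad]] := thompson_ones.
have [n tauE'] := tau_cycle b1 (iso_V th v) y.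
exists (cocycle th v y), n => g.
have := kappa_conj th'K thM v (loc_const g) y; rewrite (yfix v v1) tauE'.
rewrite (kappa_fiber th'K thM _ y1) // -{1}v1 jonesE.
have -> : tau 1 a1 v ones = a1.
  rewrite (tauE 1 a1 (m := [:: true; true]) (m' := [:: true])) //.
    by rewrite /alpha_word !big_cons !big_nil !mulg1 mulgK.
  by apply/sdiP/starts_nth => -[|[|]].
by move=> ->; rewrite (kappa_fiber th'K thM _ y1).
Qed.

End MainRelation.

(** * Outer automorphisms *)

Section ConjIso.

Variables (gT rT : finGroupType) (beta : group_iso gT rT).
Implicit Types (s t : {perm gT}) (r : {perm rT}).

Lemma conj_isoM : {morph conj_iso beta : s t / s * t}.
Proof.
by move=> s t; apply/permP => x; rewrite !(permM, permE) /= permM iso_funK.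
Qed.

Lemma conj_isoX s n : conj_iso beta (s ^+ n) = conj_iso beta s ^+ n.
Proof. exact: (morph_exp conj_isoM). Qed.

Lemma conj_iso_Inn s : (conj_iso beta s \in Inn rT) = (s \in Inn gT).
Proof.
apply/InnP/InnP => -[h sE].
  exists (iso_inv beta h) => g; apply: (can_inj (@iso_funK _ _ beta)).
  have := sE (beta g); rewrite permE /= iso_funK => ->.
  by rewrite /ad !gmulfM (morph_inv (@gmulfM _ _ beta)) !iso_invK.
exists (beta h) => x.
by rewrite permE /= sE /ad !gmulfM (morph_inv (@gmulfM _ _ beta)) iso_invK.
Qed.

Lemma coset_conj_isoX s n : s \in Aut [set: gT] ->
  (coset (Inn rT) (conj_iso beta s) ^+ n == 1) = (coset (Inn gT) s ^+ n == 1).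
Proof.
move=> As; have Ns : s \in 'N(Inn gT) := fintype.subsetP (Aut_norm_Inn gT) _ As.
have Nt := fintype.subsetP (Aut_norm_Inn rT) _ (conj_iso_Aut beta As).
have cosetX (T : finGroupType) (t : {perm T}) : t \in 'N(Inn T) ->
    (coset (Inn T) t ^+ n == 1) = (t ^+ n \in Inn T).
  move=> Nt'; rewrite -morphX //; apply/eqP/idP => [|/coset_id//].
  by apply: coset_idr; rewrite groupX.
by rewrite !cosetX // -conj_isoX conj_iso_Inn.
Qed.

Lemma order_coset_conj_iso s : s \in Aut [set: gT] ->
  #[coset (Inn rT) (conj_iso beta s)] = #[coset (Inn gT) s].
Proof.
move=> As; apply/eqP; rewrite eqn_dvd !order_dvdn coset_conj_isoX //.
by rewrite expg_order eqxx -coset_conj_isoX // expg_order eqxx.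
Qed.

Lemma coset_conj_iso_eq s r n h : r \in Aut [set: rT] ->
  (forall g, beta (s g) = ad h ((r ^+ n) (beta g))) ->
  coset (Inn rT) (conj_iso beta s) = coset (Inn rT) r ^+ n.
Proof.
move=> Ar sr; have Nr := fintype.subsetP (Aut_norm_Inn rT) _ Ar.
rewrite -[conj_iso beta s](mulKVg (r ^+ n)) coset_kerr ?morphX //.
apply/InnP; exists h => x.
by rewrite permM permE /= sr iso_invK permKV.
Qed.

End ConjIso.

Section Out.

Variables (gT rT : finGroupType) (a1 : {perm gT}) (b1 : {perm rT}).
Variables (Aa1 : a1 \in Aut [set: gT]) (Ab1 : b1 \in Aut [set: rT]).
Local Notation G := (@fraction_group gT 1 a1 (group1 _) Aa1).
Local Notation H := (@fraction_group rT 1 b1 (group1 _) Ab1).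

Lemma fraction_iso_group_iso (th : G -> H) (th' : H -> G) :
  cancel th th' -> cancel th' th -> {morph th : g h / g * h} ->
  exists (beta : group_iso gT rT) h n,
    forall g, beta (a1 g) = ad h ((b1 ^+ n) (beta g)).
Proof.
move=> thK th'K thM.
have [beta [beta' [bK b'K bM [h [n rel]]]]] := fraction_iso_relation thK th'K thM.
pose bm : {multiplicative gT -> rT} :=
  HB.pack beta (isMultiplicative.Build gT rT beta bM).
by exists (@GroupIso gT rT bm beta' bK b'K), h, n.
Qed.

(** Conjugation by [beta] preserves the order of an outer class and sends that of [a1] to a power of
    that of [b1]. *)
Lemma fraction_iso_order_dvd (th : G -> H) (th' : H -> G) :
  cancel th th' -> cancel th' th -> {morph th : g h / g * h} ->
  #[coset (Inn gT) a1] %| #[coset (Inn rT) b1].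
Proof.
move=> thK th'K thM.
have [beta [h [n rel]]] := fraction_iso_group_iso thK th'K thM.
rewrite -(order_coset_conj_iso beta Aa1) (coset_conj_iso_eq Ab1 rel).
exact: orderXdvd.
Qed.

End Out.

Theorem corollary2p12 (Gam Gam' : finGroupType)
    (a1 : {perm Gam}) (a1' : {perm Gam'})
    (Aa1 : a1 \in Aut [set: Gam]) (Aa1' : a1' \in Aut [set: Gam']) :
  isomorphic (@fraction_group Gam 1 a1 (group1 _) Aa1)
             (@fraction_group Gam' 1 a1' (group1 _) Aa1') ->
  exists beta : group_iso Gam Gam',
    (exists (h : Gam) (h' : Gam') (n n' : int),
       a1 =1 ad h \o (iso_inv beta \o expgz a1' n' \o beta) /\
       a1' =1 ad h' \o (beta \o expgz a1 n \o iso_inv beta)) /\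
    (exists f : {morphism <[coset (Inn Gam) a1]> >-> coset_of (Inn Gam')},
       isom <[coset (Inn Gam) a1]> <[coset (Inn Gam') a1']> f /\
       forall g : {perm Gam}, g \in Aut [set: Gam] ->
         coset (Inn Gam) g \in <[coset (Inn Gam) a1]> ->
         f (coset (Inn Gam) g) = coset (Inn Gam') (conj_iso beta g)).
Proof.
move=> [i]; have thM : {morph i : g h / g * h} by exact: gmulfM.
have iK := @iso_funK _ _ i; have i'K := @iso_invK _ _ i.
have [beta [h [n rel]]] := fraction_iso_group_iso iK i'K thM.
have dvd2 := fraction_iso_order_dvd i'K iK (iso_inverse_M iK i'K thM).
have ordb := order_coset_conj_iso beta Aa1; have cosb := coset_conj_iso_eq Aa1' rel.
(* One inclusion is [cosb]; divisibility of the orders for the inverse isomorphism makes it an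
   equality. *)
have cycb : <[coset (Inn Gam') (conj_iso beta a1)]> = <[coset (Inn Gam') a1']>.
  apply/eqP; rewrite eqEcard cycle_subG cosb mem_cycle /= -cosb -!orderE ordb.
  by rewrite (dvdn_leq _ dvd2).
have Na1 := fintype.subsetP (Aut_norm_Inn Gam) _ Aa1.
have Na1' := fintype.subsetP (Aut_norm_Inn Gam') _ Aa1'.
have Ncb s (As : s \in Aut [set: Gam]) :=
  fintype.subsetP (Aut_norm_Inn Gam') _ (conj_iso_Aut beta As).
exists beta; split.
  (* The class of [a1'] is thus a power of that of the conjugate of [a1]; its exponent [k] serves as
     [n], the discrepancy being inner. *)
  have /cycleP[k kE] : coset (Inn Gam') a1' \in
      <[coset (Inn Gam') (conj_iso beta a1)]>.
    by rewrite cycb cycle_id.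
  have [h' h'E] : exists h', (conj_iso beta a1 ^+ k)^-1 * a1' =1 ad h'.
    apply/InnP/coset_idr.
      by rewrite groupM ?groupV ?groupX ?Ncb.
    rewrite morphM ?groupV ?groupX ?Ncb //.
    by rewrite morphV ?groupX ?Ncb // morphX ?Ncb //= kE mulVg.
  exists (iso_inv beta h), h', (Posz k), (Posz n); split=> [g|x] /=.
    apply: (can_inj (@iso_funK _ _ beta)).
    by rewrite rel /ad !gmulfM (morph_inv (@gmulfM _ _ beta)) !iso_invK.
  have := h'E ((conj_iso beta a1 ^+ k) x); rewrite permM permK => ->.
  by rewrite -conj_isoX permE.
have dvdb : #[coset (Inn Gam') (conj_iso beta a1)] %| #[coset (Inn Gam) a1].
  by rewrite ordb.
exists (eltm_morphism dvdb); split.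
  by apply/isomP; split; [rewrite injm_eltm ordb|rewrite im_eltm cycb].
move=> g Ag /cycleP[k gk]; rewrite /= gk eltmE.
have Ng := fintype.subsetP (Aut_norm_Inn Gam) _ Ag.
(* [g] differs from [a1 ^+ k] by an inner automorphism, whose conjugate by [beta] is again inner. *)
have gI : (a1 ^+ k)^-1 * g \in Inn Gam.
  apply: coset_idr; first by rewrite groupM ?groupV ?groupX.
  by rewrite morphM ?groupV ?groupX // morphV ?groupX // morphX //= gk mulVg.
rewrite -[g](mulKVg (a1 ^+ k)) conj_isoM coset_kerr ?conj_iso_Inn //.
by rewrite conj_isoX morphX ?Ncb.
Qed.
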